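(* Let $m,n$ be positive integers. The complete bipartite graph $K_{m,n}$ is $2$-splittable (into a planar graph) if and only if $nm\le 4(n+m)-4$.
   Context: Graphs are finite and simple. For a positive integer $k$, a $k$-split operation at a vertex $v$ of a graph inserts at most $k$ new vertices $v_1,\dots,v_k$ (the copies of $v$), then, for each neighbor $w$ of $v$, adds at least one edge $(v_i,w)$ with $i\in[1,k]$, and finally deletes $v$ along with its incident edges. A $k$-split of a graph $G$ is a graph obtained by applying a $k$-split operation to each vertex of $G$ at most once. A graph $G$ is $k$-splittable if some $k$-split of $G$ is planar. *)

(* Defs.v *)
From mathcomp Require Import all_boot all_order all_algebra.
From mathcomp Require Import all_classical all_reals all_analysis.

Set Implicit Arguments.
Unset Strict Implicit.
Unset Printing Implicit Defensive.

Import Order.TTheory GRing.Theory Num.Theory.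
Import numFieldNormedType.Exports.

Record sgraph := SGraph {
  vertex :> finType;
  adj : rel vertex;
  adj_sym : symmetric adj;
  adj_irrefl : irreflexive adj
}.

Section CompleteBipartite.
Variables m n : nat.

Definition Kmn_adj (x y : 'I_m + 'I_n) : bool :=
  match x, y with
  | inl _, inr _ | inr _, inl _ => true
  | _, _ => false
  end.

Lemma Kmn_adj_sym : symmetric Kmn_adj.
Proof. by case=> x [] y. Qed.

Lemma Kmn_adj_irrefl : irreflexive Kmn_adj.
Proof. by case. Qed.

Definition Kmn : sgraph := SGraph Kmn_adj_sym Kmn_adj_irrefl.

End CompleteBipartite.

Section SplitOperation.
Variables (G : sgraph) (v : G) (j : nat) (c : 'I_j -> {set G}).

(* [v] is replaced by the copies [inr i], [i : 'I_j]; the copy [inr i] is joined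
   to the neighbours of [v] lying in [c i]. *)
Definition split_vertex : finType := ({x : G | x != v} + 'I_j)%type.

Definition split_adj (x y : split_vertex) : bool :=
  match x, y with
  | inl a, inl b => adj (val a) (val b)
  | inl a, inr i | inr i, inl a => adj v (val a) && (val a \in c i)
  | inr _, inr _ => false
  end.

Lemma split_adj_sym : symmetric split_adj.
Proof. by case=> x [] y //=; rewrite adj_sym. Qed.

Lemma split_adj_irrefl : irreflexive split_adj.
Proof. by case=> x //=; rewrite adj_irrefl. Qed.

Definition split_graph : sgraph := SGraph split_adj_sym split_adj_irrefl.

Definition covers_neighbours : Prop :=
  forall w : G, adj v w -> exists i, w \in c i.

Definition split_unsplit (S : pred G) : pred split_graph :=
  fun x => match x with inl a => S (val a) | inr _ => false end.

End SplitOperation.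

Arguments split_graph {G} v {j} c.
Arguments covers_neighbours {G} v {j} c.
Arguments split_unsplit {G} v {j} c S.

(* [ksplit k G H S]: successive k-split operations at distinct vertices of [G]
   lead from [G] to [H]; [S] holds of the vertices of [H] that are original
   vertices of [G] not split so far.  Copies are never split again. *)
Inductive ksplit (k : nat) (G : sgraph) : forall H : sgraph, pred H -> Prop :=
  | ksplit_refl : @ksplit k G G predT
  | ksplit_step (H : sgraph) (S : pred H) (v : H) (j : nat)
      (c : 'I_j -> {set H}) :
      @ksplit k G H S -> S v -> (j <= k)%N -> covers_neighbours v c ->
      @ksplit k G (split_graph v c) (split_unsplit v c S).

Arguments ksplit : clear implicits.

Section Planarity.
Variable R : realType.
Local Open Scope classical_set_scope.
Local Open Scope ring_scope.

Definition is_arc (a b : R * R) (A : set (R * R)) : Prop :=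
  exists f : R -> R * R,
    [/\ {within `[0, 1], continuous f},
        {in `[0, 1] &, injective f},
        f 0 = a, f 1 = b & f @` `[0, 1] = A].

(* [arc x y] is a point set, used only when [x] and [y] are adjacent; an edge
   has the same arc in both orientations.  An arc contains no vertices but its
   endpoints, and arcs of distinct edges meet only at a common endpoint. *)
Record is_drawing (G : sgraph) (p : G -> R * R) (arc : G -> G -> set (R * R))
    : Prop := {
  drawing_vertex_inj : injective p;
  drawing_arc_sym : forall x y, adj x y -> arc x y = arc y x;
  drawing_arc : forall x y, adj x y -> is_arc (p x) (p y) (arc x y);
  drawing_vertex_arc : forall x y z, adj x y -> arc x y (p z) -> z = x \/ z = y;
  drawing_no_crossing : forall x y u v, adj x y -> adj u v ->
    [set x; y] <> [set u; v] ->
    arc x y `&` arc u v `<=` p @` ([set x; y] `&` [set u; v])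
}.

Definition planar (G : sgraph) : Prop :=
  exists (p : G -> R * R) (arc : G -> G -> set (R * R)), is_drawing p arc.

Definition splittable (k : nat) (G : sgraph) : Prop :=
  exists (H : sgraph) (S : pred H), ksplit k G H S /\ planar H.

End Planarity.

(* Main.v *)
Require Import Defs.
From Stdlib Require Import ZArith.
From mathcomp Require Import all_boot all_order all_algebra all_fingroup.
From mathcomp Require Import ring lra zify ssrZ.
From mathcomp Require Import all_classical all_reals all_analysis.

Set Implicit Arguments.
Unset Strict Implicit.
Unset Printing Implicit Defensive.

Import Order.TTheory GRing.Theory Num.Theory.
Import numFieldNormedType.Exports.

(** The inequality [n * m <= 4 * (n + m) - 4] says that [(m - 4) * (n - 4) <= 12]
    in the integers.

    It is necessary because a 2-split of [K_{m,n}] is a bipartite graph with at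
    most [2 * (m + n)] vertices and at least [m * n] edges ([ksplit_hom]), while a
    planar bipartite graph with [V >= 3] vertices has at most [2 * V - 4] edges
    ([planar_bipartite_bound]).  Edges being drawn as arbitrary continuous arcs,
    this consequence of Euler's formula has to be derived from the topology of
    the plane, in three steps.

    - Arcs become polylines.  Near a vertex an arc is replaced by a radial
      segment up to its last exit from a small disc ([arc_middle]); the remaining
      parts of distinct arcs are disjoint compact sets, so they have disjoint
      open neighbourhoods, in which polylines can be found ([joined_open]).
      Polylines with the least number of segments are simple
      ([simple_polyline]).
    - Polylines have winding parities.  For a cycle [z] modulo 2, count the
      crossings of [z] with the horizontal ray that starts next to an edge, on
      one of its two sides.  This parity is the same at both ends of a segment
      ([cross_pair], [winding_flip]) and around a bend ([W_bend]), hence along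
      the whole edge ([winding_potential]); it changes by [z e] from one side of
      the edge [e] to the other.
    - Linear algebra replaces the count of faces ([bipartite_map_bound]).  The
      edges around each vertex are cyclically ordered, and the winding parity on
      a given side of an edge is unchanged when one turns to the next edge
      around a vertex.  It is thus a function on the faces, that is, on the
      orbits of the product of the rotations at the two colours, and it
      determines [z].  Constant functions on the faces correspond to [z = 0], so
      the cycle space has dimension at most [F - 1]; it has dimension at least
      [E - V + 1].  An orbit has at least two elements, so [2 * F <= E], and
      [E <= 2 * V - 4] follows.

    Conversely, if [m <= 4], splitting only the other side gives a subgraph of
    two disjoint copies of [K_{2,n}], which is planar ([four_by_n_planar]).  Otherwise, up to
    exchanging [m] and [n], the pair [(m, n)] is dominated by [(5, 16)], [(6, 10)]
    or [(7, 8)], for which straight-line drawings of planar splits are given by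
    coordinates and verified by computing orientations of triples of points
    ([table_planar]); a split of a larger graph contains one of a smaller
    graph. *)

(** * Rotation systems and cycles modulo 2 *)

Section CyclicSuccessor.
Variables (E V : finType) (a : E -> V) (lt : rel E).
Hypothesis lt_irr : irreflexive lt.
Hypothesis lt_trans : forall x y z, a x = a y -> a y = a z ->
  lt x y -> lt y z -> lt x z.
Hypothesis lt_total : forall x y, a x = a y -> x != y -> lt x y || lt y x.

Let le x y := (x == y) || lt x y.

Definition fibre_seq (v : V) : seq E := sort le [seq e <- enum E | a e == v].

Lemma fibre_seqE v e : (e \in fibre_seq v) = (a e == v).
Proof. by rewrite mem_sort mem_filter mem_enum andbT. Qed.

Lemma fibre_seq_uniq v : uniq (fibre_seq v).
Proof. by rewrite sort_uniq filter_uniq // enum_uniq. Qed.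

Lemma le_trans_in v : {in [pred e | a e == v] & &, transitive le}.
Proof.
move=> y x z /eqP ay /eqP ax /eqP az; rewrite /le.
case/orP=> [/eqP->//|xy] /orP [/eqP<-|yz]; first by rewrite xy orbT.
by apply/orP; right; apply: lt_trans xy yz; congruence.
Qed.

Lemma le_total_in v : {in [pred e | a e == v] &, total le}.
Proof.
move=> x y /eqP ax /eqP ay; rewrite /le; case: (altP (x =P y)) => //= xy.
by rewrite eq_sym (negbTE xy) /=; apply: lt_total => //; congruence.
Qed.

Lemma fibre_seq_sorted v : sorted le (fibre_seq v).
Proof.
apply: (@sort_sorted_in _ [pred e | a e == v]); first exact: le_total_in.
by apply/allP=> e; rewrite mem_filter => /andP[].
Qed.

Lemma lt_index v x y : a x = v -> a y = v ->
  lt x y = (index x (fibre_seq v) < index y (fibre_seq v)).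
Proof.
move=> ax ay.
have tr : {in fibre_seq v & &, transitive le}.
  move=> y1 x1 z1; rewrite !fibre_seqE => h1 h2 h3; exact: (@le_trans_in v).
have rf : {in fibre_seq v, reflexive le} by move=> z _; rewrite /le eqxx.
have xin : x \in fibre_seq v by rewrite fibre_seqE ax.
have yin : y \in fibre_seq v by rewrite fibre_seqE ay.
apply/idP/idP => [xy|].
  rewrite ltnNge; apply/negP => yx.
  have := sorted_leq_index_in tr rf (fibre_seq_sorted v) _ _ yin xin yx.
  rewrite /le => /orP [/eqP yx'|yx']; first by rewrite yx' lt_irr in xy.
  by have := lt_irr x; rewrite (lt_trans _ _ xy yx') //; congruence.
move=> ixy; have := sorted_ltn_index_in tr (fibre_seq_sorted v) _ _ xin yin ixy.
by rewrite /le => /orP [/eqP xy|//]; rewrite xy ltnn in ixy.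
Qed.

Lemma sum_lt_index (z : E -> bool) x :
  \big[addb/false]_(y | (a y == a x) && lt y x) z y =
  \big[addb/false]_(y <- take (index x (fibre_seq (a x))) (fibre_seq (a x))) z y.
Proof.
set c := fibre_seq (a x).
have cu : uniq c := fibre_seq_uniq _.
rewrite -[LHS]big_filter.
apply: perm_big; apply: uniq_perm.
- by rewrite filter_uniq // index_enum_uniq.
- by rewrite take_uniq.
move=> y; rewrite mem_filter mem_index_enum andbT.
case: (altP (a y =P a x)) => [ayx|nayx] /=.
  by rewrite (lt_index ayx erefl) in_take // fibre_seqE ayx.
symmetry; apply/negP => /mem_take; rewrite fibre_seqE; exact/negP.
Qed.

(** The rotation around a vertex: [s] sends an edge to the next one in its fibre,
    and the last one back to the first.  In the last case the sum identity says
    that a full turn adds nothing, which is where the even degree of [z] is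
    needed. *)
Lemma cyclic_successor : exists s : {perm E},
  [/\ forall e, a (s e) = a e,
      forall e, s e = e -> forall f, a f = a e -> f = e
    & forall z : E -> bool,
        (forall v, \big[addb/false]_(e | a e == v) z e = false) ->
        forall e, \big[addb/false]_(f | (a f == a (s e)) && lt f (s e)) z f
        = z e (+) \big[addb/false]_(f | (a f == a e) && lt f e) z f].
Proof.
pose s0 e := next (fibre_seq (a e)) e.
have as0 e : a (s0 e) = a e.
  by apply/eqP; rewrite -fibre_seqE mem_next fibre_seqE.
have s0_inj : injective s0.
  move=> e f efs.
  have aef : a e = a f by rewrite -as0 efs as0.
  move: efs; rewrite /s0 aef => /(congr1 (prev (fibre_seq (a f)))).
  by rewrite !prev_next // fibre_seq_uniq.
exists (perm s0_inj); split=> [e|e|z z0 e]; rewrite ?permE //.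
  rewrite /s0; set c := fibre_seq (a e) => ne f afe.
  have cu : uniq c := fibre_seq_uniq _.
  have ein : e \in c by rewrite fibre_seqE.
  have fin : f \in c by rewrite fibre_seqE afe.
  case: (rot_to ein) => i t rt.
  have ne' : next (e :: t) e = e by rewrite -rt next_rot.
  have tu : uniq (e :: t) by rewrite -rt rot_uniq.
  have : f \in e :: t by rewrite -rt mem_rot.
  case: t rt ne' tu => [|g t] rt; first by rewrite inE => _ _ /eqP.
  by rewrite /= eqxx => -> ; rewrite inE eqxx.
rewrite !sum_lt_index as0.
set c := fibre_seq (a e).
have cu : uniq c := fibre_seq_uniq _.
have ein : e \in c by rewrite fibre_seqE.
have cz : \big[addb/false]_(y <- c) z y = false.
  rewrite -[RHS](z0 (a e)) -[RHS]big_filter; apply: perm_big.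
  apply: uniq_perm => //; first by rewrite filter_uniq // index_enum_uniq.
  by move=> f; rewrite fibre_seqE mem_filter mem_index_enum andbT.
have il : index e c < size c by rewrite index_mem.
have tS : \big[addb/false]_(y <- take (index e c).+1 c) z y =
          z e (+) \big[addb/false]_(y <- take (index e c) c) z y.
  by rewrite (take_nth e) // nth_index // -cats1 big_cat big_seq1 addbC.
rewrite -tS /s0 -/c next_nth ein.
case: c cu ein cz il tS => [//|y t] cu ein cz il tS.
have [lst|] := leqP (size t) (index e (y :: t)).
  rewrite nth_default // /= eqxx big_nil take_oversize // cz //.
move=> lt_t; rewrite -[nth y t _]/(nth y (y :: t) (index e (y :: t)).+1).
by rewrite index_uniq.
Qed.

End CyclicSuccessor.

Local Open Scope ring_scope.
Lemma natr_addb (b c : bool) : (b (+) c)%:R = b%:R + c%:R :> 'F_2.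
Proof. by apply/val_inj; case: b; case: c. Qed.

Lemma natr_xsum (I : Type) (r : seq I) (P : pred I) (f : I -> bool) :
  (\big[addb/false]_(i <- r | P i) f i)%:R = \sum_(i <- r | P i) (f i)%:R :> 'F_2.
Proof. exact: (big_morph (fun b : bool => b%:R : 'F_2) natr_addb). Qed.

Lemma natr_F2_inj : injective (fun b : bool => b%:R : 'F_2).
Proof. by case; case=> // /(congr1 val). Qed.

Lemma F2E (x : 'F_2) : x = (x != 0)%:R.
Proof. by apply/val_inj; case: x => -[|[|]]. Qed.

(** The rank is lowered by one relation among the rows: they sum to zero.  This
    is the case for the transposed incidence matrix and for the face matrix. *)
Lemma rank_constl0 m n (M : 'M['F_2]_(m, n)) : (0 < m)%N ->
  const_mx (1 : 'F_2) *m M = 0 :> 'rV_n -> (\rank M < m)%N.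
Proof.
move=> m0 /sub_kermxP kM.
have := mxrankS kM.
rewrite mxrank_ker rank_rV.
have -> /= : (const_mx (1 : 'F_2) != 0 :> 'rV['F_2]_m).
  by apply/eqP => /matrixP /(_ 0 (Ordinal m0)); rewrite !mxE.
by rewrite subn_gt0.
Qed.

(** The hypothesis [potential] is what the winding parities provide: [g e] is the
    parity on one side of [e] and [g (t e)] the parity on the other side.  The
    faces are the orbits of [s * t], which lists every second edge of a facial
    walk. *)
Section BipartiteMap.
Variables (E V : finType) (al be : E -> V) (s t : {perm E}).
Hypothesis al_be : forall e f, al e != be f.
Hypothesis ends_inj : forall e f, al e = al f -> be e = be f -> e = f.
Hypothesis al_s : forall e, al (s e) = al e.
Hypothesis be_t : forall e, be (t e) = be e.
Hypothesis lonely : forall e, s e = e -> t e = e -> False.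
Hypothesis potential : forall z : E -> bool,
  (forall v, \big[addb/false]_(e | al e == v) z e = false) ->
  (forall v, \big[addb/false]_(e | be e == v) z e = false) ->
  exists2 g : E -> bool,
    forall e, g (t (s e)) = g e & forall e, z e = g e (+) g (t e).

Let P := porbits (s * t)%g.
Let B : 'M['F_2]_(#|E|, #|V|) :=
  \matrix_(i, k) ((al (enum_val i) == enum_val k)%:R
                  + (be (enum_val i) == enum_val k)%:R).
Let face (o : 'I_#|P|) : {set E} := enum_val o.
Let M : 'M['F_2]_(#|P|, #|E|) :=
  \matrix_(o, i) ((enum_val i \in face o)%:R + (t (enum_val i) \in face o)%:R).

Lemma sum_indicator (T : finType) (A : {pred T}) (f : T -> 'F_2) x : x \in A ->
  \sum_(k < #|A|) (x == enum_val k)%:R * f (enum_val k) = f x.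
Proof.
move=> xA; rewrite (bigD1 (enum_rank_in xA x)) //= enum_rankK_in // eqxx mul1r.
rewrite big1 ?addr0 // => k kx; case: eqP => [xk|]; last by rewrite mul0r.
by case/eqP: kx; apply: enum_val_inj; rewrite enum_rankK_in.
Qed.

Lemma rank_incidence : (0 < #|V|)%N -> (\rank B < #|V|)%N.
Proof.
move=> V0; rewrite -mxrank_tr; apply: rank_constl0 => //.
apply/rowP => i; rewrite !mxE.
under eq_bigr => k _ do rewrite !mxE mul1r -[X in X + _]mulr1 -[X in _ + X]mulr1.
rewrite big_split /= (sum_indicator (fun=> 1)) // (sum_indicator (fun=> 1)) //.
exact/val_inj.
Qed.

Lemma sum_porbit (g : {set E} -> 'F_2) x :
  \sum_(o < #|P|) g (face o) * (x \in face o)%:R = g (porbit (s * t)%g x).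
Proof.
have xP : porbit (s * t)%g x \in P by apply: imset_f.
rewrite -(sum_indicator g xP); apply: eq_bigr => o _; rewrite mulrC.
congr (_ * _); rewrite /face; have := enum_valP o => /imsetP[w _ ow].
rewrite ow; congr (nat_of_bool _)%:R.
by rewrite eq_porbit_mem porbit_sym.
Qed.

Lemma rank_faces : (0 < #|E|)%N -> (\rank M < #|P|)%N.
Proof.
move=> E0; apply: rank_constl0.
  have [e _] := card_gt0P E0.
  by apply/card_gt0P; exists (porbit (s * t)%g e); apply: imset_f.
apply/rowP => i; rewrite !mxE.
under eq_bigr => k _ do rewrite !mxE mulrDr.
rewrite big_split /=.
have H x : \sum_(o < #|P|) 1 * (x \in face o)%:R = 1 :> 'F_2.
  exact: (sum_porbit (fun=> 1) x).
by rewrite !H; exact/val_inj.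
Qed.

(** A cycle is the combination of the rows of [M] with coefficients its potential,
    a potential being constant on the orbits. *)
Lemma cycles_sub_faces : (kermx B <= M)%MS.
Proof.
apply/row_subP => i; set u := row i _.
have uB : u *m B = 0 by rewrite -row_mul mulmx_ker row0.
pose z e := u 0 (enum_rank e) != 0.
have uz e : u 0 (enum_rank e) = (z e)%:R by rewrite [LHS]F2E.
have zv v : \big[addb/false]_(e | al e == v) z e (+)
            \big[addb/false]_(e | be e == v) z e = false.
  apply: natr_F2_inj; rewrite natr_addb !natr_xsum.
  transitivity ((u *m B) 0 (enum_rank v)); last by rewrite uB mxE.
  rewrite (big_mkcond (fun e => al e == v)) (big_mkcond (fun e => be e == v)).
  rewrite -big_split mxE /=.
  rewrite (reindex (@enum_rank E)) /=; last first.
    by exists enum_val => e _; rewrite ?enum_valK ?enum_rankK.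
  apply: eq_bigr => e _; rewrite uz !mxE !enum_rankK mulrDr.
  by congr (_ + _); case: eqP => _; rewrite ?mulr1 ?mulr0.
have zal v : \big[addb/false]_(e | al e == v) z e = false.
  have [/existsP[f /eqP bf]|nbe] := boolP [exists f, be f == v].
    by apply: big_pred0 => e; rewrite -bf (negbTE (al_be _ _)).
  have := zv v; rewrite [X in _ (+) X]big_pred0 ?addbF // => e.
  by apply/negP => /eqP be_v; case/existsP: nbe; exists e; apply/eqP.
have zbe v : \big[addb/false]_(e | be e == v) z e = false.
  by have := zv v; rewrite zal addFb.
have [g gst zg] := potential zal zbe.
have g_orb x y : y \in porbit (s * t)%g x -> g y = g x.
  case/porbitP => k ->; elim: k => [|k IH]; first by rewrite expg0 perm1.
  by rewrite expgSr permM permM gst IH.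
pose G (O : {set E}) : 'F_2 := [exists y in O, g y]%:R.
have GE x : G (porbit (s * t)%g x) = (g x)%:R.
  congr (nat_of_bool _)%:R; apply/existsP/idP => [[y /andP[yx gy]]|gx].
    by rewrite -(g_orb _ _ yx).
  by exists x; rewrite porbit_id.
apply/submxP; exists (\row_o G (face o)).
apply/rowP => j; rewrite -[j]enum_valK uz zg natr_addb -!GE -!sum_porbit.
rewrite -big_split [RHS]mxE; apply: eq_bigr => o _.
by rewrite !mxE enum_rankK mulrDr.
Qed.

Lemma partition_P : finset.partition P [set: E].
Proof.
apply/and3P; split.
- apply/eqP/setP => x; rewrite !inE; apply/bigcupP.
  by exists (porbit (s * t)%g x); [exact: imset_f | exact: porbit_id].
- apply/finset.trivIsetP => _ _ /imsetP[x _ ->] /imsetP[y _ ->].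
  apply: contraR => /pred0Pn[z /andP[/= zx zy]].
  by apply/eqP; move: zx zy; rewrite -!eq_porbit_mem => /eqP <- /eqP <-.
- by apply/imsetP => -[x _ /setP /(_ x)]; rewrite inE porbit_id.
Qed.

(** Compare [#|E| - (#|V| - 1)], a lower bound for the dimension of the cycle
    space, with the rank of [M], at most the number of faces minus one.  A face
    that is a fixed point of [s * t] would be a digon around an isolated edge. *)
Lemma bipartite_map_bound : (0 < #|E|)%N -> (#|E| + 4 <= 2 * #|V|)%N.
Proof.
move=> E0.
have V0 : (0 < #|V|)%N.
  by have [e _] := card_gt0P E0; apply/card_gt0P; exists (al e).
have h1 := rank_incidence V0; have h2 := rank_faces E0.
have := mxrankS cycles_sub_faces; rewrite mxrank_ker => h3.
have h4 : (2 * #|P| <= #|E|)%N.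
  rewrite -[X in (_ <= X)%N]cardsT (card_partition partition_P) mulnC.
  rewrite -sum_nat_const; apply: leq_sum => _ /imsetP[x _ ->].
  rewrite ltn_neqAle eq_sym lt0n card_porbit_neq0 andbT.
  apply/negP => /eqP c1; have := iter_porbit (s * t)%g x; rewrite c1 /= permM => st.
  have sx : s x = x.
    by apply: ends_inj; rewrite ?al_s // -(be_t (s x)) st.
  by apply: (lonely sx); rewrite -{1}sx.
by lia.
Qed.
End BipartiteMap.
Local Close Scope ring_scope.

(** Winding parities give potentials.  The expression
    [c (al e) (+) sum] is the parity just before [e] in the order around [al e],
    that is, on one side of [e], and the similar expression at [be e] is the
    parity on the other side.  By [cyclic_successor], going to the next edge
    passes [e] itself and nothing else. *)
Lemma rotation_bound (E V : finType) (al be : E -> V) (lta ltb : rel E) :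
  (forall e f, al e != be f) ->
  (forall e f, al e = al f -> be e = be f -> e = f) ->
  (forall e, (forall f, al f = al e -> f = e) ->
             (forall f, be f = be e -> f = e) -> False) ->
  irreflexive lta ->
  (forall x y z, al x = al y -> al y = al z -> lta x y -> lta y z -> lta x z) ->
  (forall x y, al x = al y -> x != y -> lta x y || lta y x) ->
  irreflexive ltb ->
  (forall x y z, be x = be y -> be y = be z -> ltb x y -> ltb y z -> ltb x z) ->
  (forall x y, be x = be y -> x != y -> ltb x y || ltb y x) ->
  (forall z : E -> bool,
     (forall v, \big[addb/false]_(e | al e == v) z e = false) ->
     (forall v, \big[addb/false]_(e | be e == v) z e = false) ->
     exists c : V -> bool, forall e,
       (c (al e) (+) \big[addb/false]_(f | (al f == al e) && lta f e) z f) (+)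
       (c (be e) (+) \big[addb/false]_(f | (be f == be e) && ltb f e) z f)
       = z e) ->
  0 < #|E| -> #|E| + 4 <= 2 * #|V|.
Proof.
move=> al_be inj lonely ia ta toa ib tb tob winding.
have [s [als sfix snext]] := cyclic_successor ia ta toa.
have [t [bet tfix tnext]] := cyclic_successor ib tb tob.
apply: (bipartite_map_bound al_be inj als bet) => [e se te|z za zb].
  by apply: (lonely e) => f; [exact: sfix | exact: tfix].
have [c cz] := winding z za zb.
pose R e := c (al e) (+) \big[addb/false]_(f | (al f == al e) && lta f e) z f.
pose L e := c (be e) (+) \big[addb/false]_(f | (be f == be e) && ltb f e) z f.
have RL e : R e (+) L e = z e by exact: cz.
have Rs e : R (s e) = L e.
  rewrite /R snext // als addbCA -/(R e) -RL.
  by case: (R e); case: (L e).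
have Lt e : L (t e) = R e.
  rewrite /L tnext // bet addbCA -/(L e) -RL.
  by case: (R e); case: (L e).
by exists L => e; rewrite Lt ?Rs // addbC RL.
Qed.

(** * Crossing parities of segments *)

Local Open Scope ring_scope.
Section SegmentCrossings.
Variable R : realFieldType.
Implicit Types a b c d x y q : (R * R)%type.

Definition on_seg a b x : Prop :=
  exists2 t : R, 0 <= t <= 1 &
    x = (a.1 + t * (b.1 - a.1), a.2 + t * (b.2 - a.2)).

Lemma on_segC a b x : on_seg a b x -> on_seg b a x.
Proof.
case=> t t01 ->; exists (1 - t); first by lra.
by congr pair; ring.
Qed.

Lemma on_seg_left a b : on_seg a b a.
Proof. by exists 0; [lra | case: a => a1 a2 /=; congr pair; ring]. Qed.

Lemma on_seg_right a b : on_seg a b b.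
Proof. exact/on_segC/on_seg_left. Qed.

(** Segments are seen as graphs over the second coordinate, the height: later on,
    all nodes have distinct heights, so no segment is horizontal.  Hence [slope]
    is the inverse of the usual one and [x_at a b h] is the abscissa of the line
    [ab] at height [h]. *)
Definition slope a b : R := (b.1 - a.1) / (b.2 - a.2).
Definition x_at a b (h : R) : R := a.1 + (h - a.2) * slope a b.

Lemma slopeC a b : slope a b = slope b a.
Proof. by rewrite /slope -opprB -[b.2 - _]opprB invrN mulrNN. Qed.

Lemma x_at_right a b : a.2 != b.2 -> x_at a b b.2 = b.1.
Proof.
move=> ab; rewrite /x_at /slope mulrC divfK ?subr_eq0 1?eq_sym //.
by rewrite addrC subrK.
Qed.

Lemma x_at_left a b : x_at a b a.2 = a.1.
Proof. by rewrite /x_at subrr mul0r addr0. Qed.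

Lemma x_atC a b h : a.2 != b.2 -> x_at a b h = x_at b a h.
Proof.
move=> ab; have := x_at_right ab; rewrite /x_at (slopeC b a) => <-; ring.
Qed.

Lemma on_seg_x_at a b h : a.2 < b.2 -> a.2 <= h <= b.2 -> on_seg a b (x_at a b h, h).
Proof.
move=> ab /andP[ah hb]; exists ((h - a.2) / (b.2 - a.2)).
  by rewrite divr_ge0 ?ler_pdivrMr; lra.
congr pair; first by rewrite /x_at /slope; congr (_ + _); rewrite mulrAC mulrA.
rewrite divfK; first by ring.
by rewrite subr_eq0 gt_eqF.
Qed.

(** Crossing of [cd] with the horizontal ray from [q] to the right.  The
    inequalities are strict, so that [ray q c d] is false if [q] is an end of
    [cd]; the segments at [q] are taken into account by [before]. *)
Definition ray q c d : bool :=
  ((c.2 < q.2 < d.2) || (d.2 < q.2 < c.2)) && (q.1 < x_at c d q.2).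

(** The counterclockwise order of the directions around [x], starting from the
    horizontal direction to the right: first the directions upwards, then those
    downwards, and in both halves by decreasing [slope]. *)
Definition angle_lt x y y' : bool :=
  ((x.2 < y.2) && ~~ (x.2 < y'.2)) ||
  (((x.2 < y.2) == (x.2 < y'.2)) && (slope x y' < slope x y)).

(** Crossing of [cd] with a ray at [a] that is turned from the horizontal until
    just before the direction of [b].  Thus [ray a c d (+) before a b c d] counts
    the crossings of [cd] with a path to infinity from a point very close to the
    segment [ab] and to [a], on the right-hand side from [a] to [b]. *)
Definition before a b c d : bool :=
  ((c == a) && angle_lt a d b) (+) ((d == a) && angle_lt a c b).

(** The region swept by the horizontal ray while its origin moves from [a] up to
    [b].  Counting the end [b] but not [a] makes [ab] itself contribute one. *)
Definition wedge a b c : bool :=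
  (c == b) || ((a.2 < c.2 < b.2) && (x_at a b c.2 < c.1)).

Lemma rayC q c d : ray q c d = ray q d c.
Proof.
rewrite /ray orbC; have [cd|cd] := eqVneq c.2 d.2; last by rewrite x_atC.
rewrite cd; case: (ltgtP d.2 q.2) => //=.
Qed.

Lemma beforeC a b c d : before a b c d = before a b d c.
Proof. by rewrite /before addbC. Qed.

Lemma affine_sign_const (p q y1 y2 : R) :
  (forall y : R, y1 <= y <= y2 -> p + q * y != 0) -> y1 <= y2 ->
  (p + q * y1 < 0) = (p + q * y2 < 0).
Proof.
move=> nz y12.
have n1 := nz y1; have n2 := nz y2.
have {n1} n1 : p + q * y1 != 0 by apply: n1; lra.
have {n2} n2 : p + q * y2 != 0 by apply: n2; lra.
have q0 (y : R) : p + q * y = 0 -> ~~ (y1 <= y <= y2).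
  by move=> y0; apply/negP => /nz; rewrite y0 eqxx.
have [->//|qn] := eqVneq q 0; first by rewrite !mul0r.
have {q0} := q0 (- p / q); rewrite mulrCA mulfV // mulr1 addrN => /(_ erefl).
set w := - p / q; have pw : p = - (q * w) by rewrite /w mulrCA mulfV // mulr1 opprK.
rewrite pw in n1 n2 *.
have e1 : - (q * w) + q * y1 = q * (y1 - w) by ring.
have e2 : - (q * w) + q * y2 = q * (y2 - w) by ring.
rewrite e1 e2 in n1 n2 *.
have [q0|q0|q0] := ltgtP q 0; last by rewrite q0 eqxx in qn.
  rewrite !(nmulr_rlt0 _ q0); case: (leP y1 w) => h1; case: (leP w y2) => h2 //= _;
    apply/idP/idP; lra.
rewrite !(pmulr_rlt0 _ q0); case: (leP y1 w) => h1; case: (leP w y2) => h2 //= _;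
  apply/idP/idP; lra.
Qed.

(** Two segments without common point are in the same left-right order at all
    common heights, by the intermediate value theorem for affine functions. *)
Lemma side_const a b c d (y1 y2 : R) : a.2 < b.2 -> c.2 < d.2 ->
  (forall x, on_seg a b x -> on_seg c d x -> False) ->
  a.2 <= y1 <= b.2 -> c.2 <= y1 <= d.2 -> a.2 <= y2 <= b.2 -> c.2 <= y2 <= d.2 ->
  (x_at a b y1 < x_at c d y1) = (x_at a b y2 < x_at c d y2).
Proof.
move=> ab cd dis.
wlog y12 : y1 y2 / y1 <= y2.
  by move=> W *; case: (leP y1 y2) => [|/ltW] yy; [|symmetry]; apply: W.
move=> ay1 cy1 ay2 cy2.
pose q := slope a b - slope c d.
pose p := (a.1 - a.2 * slope a b) - (c.1 - c.2 * slope c d).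
have D (y : R) : (x_at a b y < x_at c d y) = (p + q * y < 0).
  rewrite -subr_lt0; congr (_ < _); rewrite /x_at /p /q; ring.
rewrite !D; apply: affine_sign_const => // y yy; apply/eqP => D0.
have xx : x_at a b y = x_at c d y.
  apply/eqP; rewrite -subr_eq0 -D0; apply/eqP; rewrite /x_at /p /q; ring.
apply: (dis (x_at a b y, y)); first by apply: on_seg_x_at => //; lra.
by rewrite xx; apply: on_seg_x_at => //; lra.
Qed.

(** The boundary of the region [wedge a b] consists of [ab] and of the two rays, so
    a segment that avoids [ab] crosses the rays as often, modulo 2, as it has
    ends in the region. *)
Lemma cross_disjoint a b c d : a.2 < b.2 -> c.2 < d.2 ->
  a.2 != c.2 -> a.2 != d.2 -> b.2 != c.2 -> b.2 != d.2 ->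
  (forall x, on_seg a b x -> on_seg c d x -> False) ->
  ray a c d (+) ray b c d = wedge a b c (+) wedge a b d.
Proof.
move=> ab cd ac ad bc bd dis.
have cb : c == b = false by apply: contraNF bc => /eqP->.
have db : d == b = false by apply: contraNF bd => /eqP->.
rewrite /ray /wedge cb db /=.
rewrite -[X in X < x_at c d a.2](x_at_left a b).
rewrite -[X in X < x_at c d b.2](@x_at_right a b) ?lt_eqF //.
rewrite -[X in x_at a b c.2 < X](x_at_left c d).
rewrite -[X in x_at a b d.2 < X](@x_at_right c d) ?lt_eqF //.
have S (y1 y2 : R) := @side_const a b c d y1 y2 ab cd dis.
have dac : (d.2 < a.2 < c.2) = false by apply/negP; lra.
have dbc : (d.2 < b.2 < c.2) = false by apply/negP; lra.
rewrite dac dbc !orbF.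
case: (ltgtP a.2 c.2) => [ac'|ca|e]; last by rewrite e eqxx in ac.
  rewrite /=; case: (ltP c.2 b.2) => [cb'|bc'] /=; last first.
    have -> : (a.2 < d.2 < b.2) = false by apply/negP; lra.
    by [].
  case: (ltgtP b.2 d.2) => [bd'|db'|e]; last by rewrite e eqxx in bd.
    by rewrite andbF addbF; apply: S; lra.
  have -> : a.2 < d.2 by lra.
  by rewrite /= (S c.2 d.2) ?addbb //; lra.
rewrite /=; case: (ltP a.2 d.2) => [ad'|da] /=; last first.
  have -> : (c.2 < b.2 < d.2) = false by apply/negP; lra.
  by [].
case: (ltgtP b.2 d.2) => [bd'|db'|e]; last by rewrite e eqxx in bd.
  have -> : c.2 < b.2 by lra.
  by rewrite /= (S a.2 b.2) ?addbb //; lra.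
by rewrite andbF addbF; apply: S; lra.
Qed.

Lemma cross_share_low a b d : a.2 < b.2 -> a.2 < d.2 -> b.2 != d.2 ->
  ray b a d (+) angle_lt a d b = wedge a b d.
Proof.
move=> ab ad bd.
have db : d == b = false by apply: contraNF bd => /eqP->.
have dba : (d.2 < b.2 < a.2) = false by apply/negP; lra.
rewrite /ray /angle_lt /wedge db dba ab ad orbF /=.
rewrite -[X in X < x_at a d b.2](@x_at_right a b) ?lt_eqF //.
rewrite -[X in x_at a b d.2 < X](@x_at_right a d) ?lt_eqF //.
have E h : a.2 < h -> (x_at a b h < x_at a d h) = (slope a b < slope a d).
  by move=> ah; rewrite /x_at ltrD2l ltr_pM2l ?subr_gt0.
rewrite !E //; case: (ltgtP b.2 d.2) => [h|h|e] //=; first by rewrite addbb.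
by rewrite e eqxx in bd.
Qed.

Lemma cross_share_high a b c : a.2 < b.2 -> c.2 < b.2 -> a.2 != c.2 ->
  slope a b != slope c b ->
  ray a c b (+) angle_lt b c a = ~~ wedge a b c.
Proof.
move=> ab cb ac sl.
have ncb : c == b = false by apply: contraTF cb => /eqP->; rewrite ltxx.
have bac : (b.2 < a.2 < c.2) = false by apply/negP; lra.
have nba : b.2 < a.2 = false by apply/negP; lra.
have nbc : b.2 < c.2 = false by apply/negP; lra.
rewrite /ray /angle_lt /wedge ncb bac ab cb nba nbc orbF andbT /=.
rewrite -[X in X < x_at c b a.2](x_at_left a b).
rewrite -[X in x_at a b c.2 < X](x_at_left c b).
have E h : h < b.2 -> (x_at a b h < x_at c b h) = (slope c b < slope a b).
  move=> hb; rewrite (@x_atC a b) ?lt_eqF // (@x_atC c b) ?lt_eqF //.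
  rewrite /x_at ltrD2l ltr_nM2l ?subr_lt0 //.
  by rewrite (slopeC b c) (slopeC b a).
rewrite !E // (slopeC b a) (slopeC b c).
have T : (slope a b < slope c b) = ~~ (slope c b < slope a b).
  by rewrite -leNgt lt_neqAle sl.
rewrite T; case: (ltgtP a.2 c.2) => [h|h|e] //=; last by rewrite e eqxx in ac.
by rewrite addbN addbb.
Qed.

Definition meet_at_ends a b c d : Prop := forall x, on_seg a b x -> on_seg c d x ->
  (x = a \/ x = b) /\ (x = c \/ x = d).

Lemma slope_on_seg x y y' : x.2 != y.2 -> x.2 != y'.2 ->
  (x.2 < y.2) = (x.2 < y'.2) -> slope x y = slope x y' ->
  on_seg x y y' \/ on_seg x y' y.
Proof.
wlog W : y y' / `|y'.2 - x.2| <= `|y.2 - x.2|.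
  move=> W h1 h2 h3 h4; case: (leP `|y'.2 - x.2| `|y.2 - x.2|) => h.
    exact: W.
  by rewrite or_comm; apply: W => //; exact: ltW.
move=> xy xy' up sl; left; exists ((y'.2 - x.2) / (y.2 - x.2)).
  have [u|u] := ltP x.2 y.2.
    have u' : x.2 < y'.2 by rewrite -up.
    move: W; rewrite !gtr0_norm ?subr_gt0 // => W.
    by rewrite divr_ge0 ?ler_pdivrMr ?subr_gt0 // ?mul1r // subr_ge0 ltW.
  have {}u : y.2 < x.2 by rewrite lt_neqAle eq_sym xy.
  have u' : y'.2 < x.2.
    by move: up; case: (ltgtP x.2 y'.2) xy' => // _ _; case: (ltgtP x.2 y.2) u.
  move: W; rewrite !ltr0_norm ?subr_lt0 // lerN2 => W.
  apply/andP; split; last by rewrite ler_ndivrMr ?subr_lt0 // mul1r.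
  by apply: mulr_le0; rewrite ?invr_le0 subr_le0 ltW.
have d0 : y.2 - x.2 != 0 by rewrite subr_eq0 eq_sym.
have d0' : y'.2 - x.2 != 0 by rewrite subr_eq0 eq_sym.
rewrite [LHS]surjective_pairing; congr pair; last by rewrite divfK //; ring.
have -> : y'.1 = x.1 + (y'.2 - x.2) * slope x y'.
  by rewrite /slope mulrC divfK //; ring.
by rewrite -sl /slope; congr (_ + _); rewrite mulrAC mulrA.
Qed.

(** The identity of [cross_disjoint] persists for segments sharing one end with
    [ab], thanks to the corrections [before].  The left-hand side is symmetric in
    [a] and [b]: it compares the two sides of [ab], seen from [a] and from [b]. *)
Lemma cross_pair a b c d :
  (forall x y, x \in [:: a; b; c; d] -> y \in [:: a; b; c; d] -> x.2 = y.2 -> x = y) ->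
  a != b -> c != d -> meet_at_ends a b c d -> ~ (a = c /\ b = d) -> ~ (a = d /\ b = c) ->
  a.2 < b.2 ->
  (ray a c d (+) before a b c d) (+) (ray b c d (+) before b a c d) =
  wedge a b c (+) wedge a b d.
Proof.
move=> dist nab ncd meet n1 n2 ab.
wlog cd : c d dist ncd meet n1 n2 / c.2 < d.2.
  move=> W; have : c.2 != d.2.
    by apply: contraNN ncd => /eqP e; apply/eqP; apply: dist; rewrite ?inE ?eqxx ?orbT.
  rewrite neq_lt => /orP[|dc]; first exact: W.
  rewrite (rayC a) (rayC b) (beforeC a) (beforeC b) addbC [RHS]addbC addbC; apply: W => //.
  - by move=> x y xi yi; apply: dist; [move: xi | move: yi]; rewrite !inE;
    do !case/orP => [->|]; rewrite ?orbT // => ->; rewrite ?orbT.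
  - by rewrite eq_sym.
  - by move=> x xa xc; have [h1 [h2|h2]] := meet x xa (on_segC xc); split; auto.
have D x y : x \in [:: a; b; c; d] -> y \in [:: a; b; c; d] -> x != y -> x.2 != y.2.
  by move=> xi yi; apply: contraNN => /eqP e; apply/eqP; exact: dist.
have ain : a \in [:: a; b; c; d] by rewrite !inE eqxx.
have bin : b \in [:: a; b; c; d] by rewrite !inE eqxx ?orbT.
have cin : c \in [:: a; b; c; d] by rewrite !inE eqxx ?orbT.
have din : d \in [:: a; b; c; d] by rewrite !inE eqxx ?orbT.
have nba : (b == a) = false by rewrite eq_sym; apply/negbTE.
have ndc : (d == c) = false by rewrite eq_sym; apply/negbTE.
have ray0 q e f : e.2 <= q.2 -> f.2 <= q.2 -> ray q e f = false.
  by move=> h1 h2; rewrite /ray; apply/negP => /andP[/orP[]]; lra.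
have ray1 q e f : q.2 <= e.2 -> q.2 <= f.2 -> ray q e f = false.
  by move=> h1 h2; rewrite /ray; apply/negP => /andP[/orP[]]; lra.
have rayl q f : ray q q f = false.
  by rewrite /ray !ltxx andbF.
have rayr q f : ray q f q = false by rewrite rayC rayl.
have [ca|nca] := eqVneq c a.
  subst c; have nbd : b != d by apply/eqP => bd; apply: n1.
  rewrite rayl /before eqxx (eq_sym a b) nba ndc (eq_sym d b) (negbTE nbd) /= addbF.
  have -> : wedge a b a = false by rewrite /wedge ltxx (eq_sym a b) nba.
  rewrite -(@cross_share_low a b d) ?D //.
  by case: (ray _ _ _); case: (angle_lt _ _ _).
have [db|ndb] := eqVneq d b.
  subst d; have nac : a != c by rewrite eq_sym.
  have nbc : c == b = false by apply/negbTE.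
  rewrite rayr /before (negbTE nca) nba nbc eqxx /= addbF.
  have -> : wedge a b b = true by rewrite /wedge eqxx.
  have := @cross_share_high a b c ab cd; rewrite D // => /(_ erefl) H.
  rewrite addbT -H.
    by case: (ray _ _ _); case: (angle_lt _ _ _).
  have up : (b.2 < a.2) = (b.2 < c.2) by rewrite !ltNge !ltW.
  apply/eqP => sl; have sl' : slope b a = slope b c by rewrite slopeC sl slopeC.
  have [||/on_segC h|/on_segC h] := @slope_on_seg b a c _ _ up sl';
    rewrite ?gt_eqF //.
    by case: (meet c h (on_seg_left _ _)) => -[/eqP|/eqP]; rewrite ?(negbTE nca) ?nbc.
  case: (meet a (on_seg_left _ _) h) => _ [/eqP|/eqP]; rewrite ?(negbTE nac) //.
  by rewrite eq_sym nba.
have [da|nda] := eqVneq d a.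
  subst d; rewrite /before (negbTE nca) eqxx (negbTE nab).
  have cb : c == b = false by apply/eqP => cb; rewrite cb in cd; lra.
  rewrite cb /= !rayr !ray0 ?ltW //; last by lra.
  have -> : angle_lt a c b = false by rewrite /angle_lt ab;
    have -> : a.2 < c.2 = false by apply/negP; lra.
  rewrite /wedge cb ltxx (eq_sym a b) nba.
  by have -> : a.2 < c.2 = false by apply/negP; lra.
have [cb|ncb] := eqVneq c b.
  subst c; rewrite /before (negbTE nca) (negbTE nda) (negbTE ndb) eqxx /=.
  rewrite rayl ray1 ?ltW //; last by lra.
  rewrite /wedge eqxx (negbTE ndb).
  have -> : (a.2 < d.2 < b.2) = false by apply/negP; lra.
  rewrite /angle_lt cd; have -> : b.2 < a.2 = false by apply/negP; lra.
  by [].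
rewrite /before (negbTE nca) (negbTE nda) (negbTE ncb) (negbTE ndb) /= !addbF.
apply: cross_disjoint => //; try by apply: D => //; rewrite eq_sym.
move=> x xa xc; have [[->|->] [/eqP|/eqP]] := meet x xa xc.
- by rewrite eq_sym (negbTE nca).
- by rewrite eq_sym (negbTE nda).
- by rewrite eq_sym (negbTE ncb).
- by rewrite eq_sym (negbTE ndb).
Qed.

End SegmentCrossings.

Section WindingParity.
Variable R : realFieldType.
Implicit Types a b c d x y q : (R * R)%type.

Lemma angle_lt_irr x y : angle_lt x y y = false.
Proof. by rewrite /angle_lt ltxx; case: (_ < _). Qed.

Lemma angle_lt_trans x y y' y'' : angle_lt x y y' -> angle_lt x y' y'' -> angle_lt x y y''.
Proof.
rewrite /angle_lt; case: (x.2 < y.2); case: (x.2 < y'.2); case: (x.2 < y''.2) => //=;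
  move=> h1 h2; exact: lt_trans h2 h1.
Qed.

Lemma meet_ends_sym a b c d : meet_at_ends a b c d -> meet_at_ends c d a b.
Proof. by move=> m x xc xa; have [] := m x xa xc. Qed.

Lemma meet_ends_swap a b c d : meet_at_ends a b c d -> meet_at_ends b a c d.
Proof. by move=> m x /on_segC xa xc; have [[]] := m x xa xc; auto. Qed.

Lemma meet_ends_self a b : a != b -> ~ meet_at_ends a b a b.
Proof.
move=> ab m.
have h : on_seg a b (a.1 + 2^-1 * (b.1 - a.1), a.2 + 2^-1 * (b.2 - a.2)).
  by exists 2^-1 => //; lra.
case/eqP: ab; rewrite [a]surjective_pairing [b]surjective_pairing.
by have [[e|e] _] := m _ h h; have := congr1 fst e; have := congr1 snd e => /= *;
  congr pair; lra.
Qed.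

Lemma angle_lt_total x y y' : x.2 != y.2 -> x.2 != y'.2 ->
  meet_at_ends x y x y' -> angle_lt x y y' (+) angle_lt x y' y.
Proof.
move=> xy xy' m.
have xny : x != y by apply: contraNN xy => /eqP->.
have xny' : x != y' by apply: contraNN xy' => /eqP->.
rewrite /angle_lt; case: (boolP ((x.2 < y.2) == (x.2 < y'.2))) => [/eqP up|up].
  have sl : slope x y != slope x y'.
    apply/eqP => /(slope_on_seg xy xy' up) [s|s].
      have [[e|e] _] := m y' s (on_seg_right _ _); first by rewrite e eqxx in xny'.
      by apply: (meet_ends_self xny'); move: m; rewrite e.
    have [_ [e|e]] := m y (on_seg_right _ _) s; first by rewrite e eqxx in xny.
    by apply: (meet_ends_self xny); move: m; rewrite -e.
  rewrite up eqxx /=; case: (x.2 < y'.2) => /=; case: (ltgtP (slope x y) _) sl => //.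
by rewrite eq_sym (negbTE up) /=; move: up; case: (x.2 < y.2); case: (x.2 < y'.2).
Qed.

Variables (I : finType) (P : pred I) (s t : I -> (R * R)%type) (z : I -> bool).

(** The winding parity of the cycle [z] around a point very close to the segment
    [ab] and to [a], on the right-hand side from [a] to [b]. *)
Definition winding a b : bool :=
  \big[addb/false]_(j | P j) (z j && (ray a (s j) (t j) (+) before a b (s j) (t j))).

(** A chain is closed if its boundary vanishes on every function of points; in
    this form it applies at once to the indicator of a [wedge]. *)
Hypothesis closed : forall h : R * R -> bool,
  \big[addb/false]_(j | P j) (z j && (h (s j) (+) h (t j))) = false.
Hypothesis snd_inj : forall j j' x y, P j -> P j' ->
  x \in [:: s j; t j] -> y \in [:: s j'; t j'] -> x.2 = y.2 -> x = y.
Hypothesis nondeg : forall j, P j -> s j != t j.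
Hypothesis meet : forall j j', P j -> P j' -> j != j' ->
  meet_at_ends (s j) (t j) (s j') (t j').

(** Summing [cross_pair] over all segments, the terms [wedge] cancel because the
    chain is closed.  The segment [ab] itself violates [cross_pair] by one, which
    leaves [z i]. *)
Lemma winding_up i a b : P i -> (a = s i /\ b = t i) \/ (a = t i /\ b = s i) ->
  a.2 < b.2 -> winding a b (+) winding b a = z i.
Proof.
move=> Pi ab ltab.
have nab : a != b by apply: contraTN ltab => /eqP->; rewrite ltxx.
rewrite /winding -big_split /=.
have E j : P j ->
  (z j && (ray a (s j) (t j) (+) before a b (s j) (t j))) (+)
  (z j && (ray b (s j) (t j) (+) before b a (s j) (t j))) =
  (z j && (wedge a b (s j) (+) wedge a b (t j))) (+) ((j == i) && z i).
  move=> Pj; rewrite -andb_addr; have [->|ji] := eqVneq j i; last first.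
    rewrite addbF; congr (_ && _).
    have mj : meet_at_ends a b (s j) (t j).
      have mij := meet Pi Pj; rewrite eq_sym in mij.
      by case: ab => -[-> ->]; [|apply/meet_ends_swap]; apply: mij.
    apply: cross_pair => //.
    - have abin x : x \in [:: a; b; s j; t j] ->
        exists2 k, P k & x \in [:: s k; t k].
        rewrite !inE => /or4P[] /eqP->; [exists i|exists i|exists j|exists j] => //;
        by rewrite !inE ?eqxx ?orbT //; case: ab => -[ea eb]; rewrite ?ea ?eb eqxx ?orbT.
      by move=> x y /abin[k Pk xk] /abin[l Pl yl]; exact: snd_inj Pk Pl xk yl.
    - exact: nondeg.
    - by case=> ea eb; rewrite -ea -eb in mj; exact: meet_ends_self mj.
    - case=> ea eb; rewrite -ea -eb in mj; apply: meet_ends_self nab _.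
      exact: meet_ends_swap (meet_ends_sym mj).
  have rl q f : ray q q f = false by rewrite /ray !ltxx andbF.
  have rr q f : ray q f q = false by rewrite rayC rl.
  have nba : (b == a) = false by rewrite eq_sym (negbTE nab).
  have wb : wedge a b a = false by rewrite /wedge ltxx (negbTE nab).
  have wt : wedge a b b = true by rewrite /wedge eqxx.
  by case: ab => -[<- <-];
     rewrite !rl !rr /before !eqxx !nba !(negbTE nab) !angle_lt_irr wb wt /=; case: (z i).
rewrite (eq_bigr _ E) big_split /= closed addFb (bigD1 i) //= eqxx big1 ?addbF //.
by move=> j /andP[_ /negbTE->].
Qed.

(** The right-hand side of [ab] seen from [b] is its left-hand side seen from [a]:
    crossing the segment changes the winding parity by its weight. *)
Lemma winding_flip i : P i -> winding (s i) (t i) (+) winding (t i) (s i) = z i.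
Proof.
move=> Pi; have := nondeg Pi; have inj := @snd_inj i i (s i) (t i) Pi Pi.
have [h|h|h] := ltgtP (s i).2 (t i).2.
- by move=> _; apply: winding_up => //; left.
- by rewrite addbC => _; apply: winding_up => //; right.
- by move=> /eqP; case; apply: inj; rewrite ?inE ?eqxx ?orbT.
Qed.

End WindingParity.
Local Close Scope ring_scope.

(** * Winding parities along polylines *)

Local Open Scope ring_scope.
Lemma xsum_only (T : finType) (P : pred T) (u : T) (F : T -> bool) : P u ->
  \big[addb/false]_(x | P x) ((x == u) && F x) = F u.
Proof.
move=> Pu; rewrite (bigD1 u) //= eqxx big1 ?addbF // => x /andP[_ /negbTE->] //.
Qed.

(** The polyline of [e] has the nodes [pts e 0], ..., [pts e (k e)]; a function on
    [nat] with a bound makes sums over the segments telescope.  The disjunction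
    in [polyline_nodes] allows common nodes of distinct edges at their ends
    only. *)
Record polyline_drawing (R : realFieldType) (E V : finType) (al be : E -> V)
    (p : V -> (R * R)%type) (k : E -> nat) (pts : E -> nat -> (R * R)%type) : Prop := {
  polyline_nonempty : forall e, (0 < k e)%N;
  polyline_first : forall e, pts e 0 = p (al e);
  polyline_last : forall e, pts e (k e) = p (be e);
  polyline_vertex_inj : injective p;
  polyline_nodes : forall e f i j, (i <= k e)%N -> (j <= k f)%N ->
    pts e i = pts f j ->
    (e = f /\ i = j) \/ ((i = 0%N \/ i = k e) /\ (j = 0%N \/ j = k f));
  polyline_meet : forall e f i j, (i < k e)%N -> (j < k f)%N -> (e, i) <> (f, j) ->
    meet_at_ends (pts e i) (pts e i.+1) (pts f j) (pts f j.+1)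
}.

Section Polylines.
Variables (R : realFieldType) (E V : finType) (al be : E -> V).
Variables (p : V -> (R * R)%type) (k : E -> nat) (pts : E -> nat -> (R * R)%type).
Hypothesis al_be : forall e f, al e != be f.
Hypothesis draw : polyline_drawing al be p k pts.
Hypothesis pts_snd : forall e f i j, (i <= k e)%N -> (j <= k f)%N ->
  (pts e i).2 = (pts f j).2 -> pts e i = pts f j.

Let k0 := polyline_nonempty draw.
Let pts0 := polyline_first draw.
Let ptsk := polyline_last draw.
Let p_inj := @polyline_vertex_inj _ _ _ _ _ _ _ _ draw.
Let pts_inj := @polyline_nodes _ _ _ _ _ _ _ _ draw.
Let pts_meet := @polyline_meet _ _ _ _ _ _ _ _ draw.

Lemma pts_al e f i : (i <= k e)%N -> (pts e i == p (al f)) = (i == 0%N) && (al e == al f).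
Proof.
move=> ie; apply/eqP/andP => [|[/eqP-> /eqP<-]]; last exact: pts0.
rewrite -pts0 => H.
have K : i = 0%N -> i == 0%N /\ al e == al f.
  by move=> i0; move: H; rewrite i0 !pts0 => /p_inj ->.
case: (pts_inj ie (leq0n _) H) => [[_ /K]|[[/K|ik] _]] //.
by move: H; rewrite ik ptsk pts0 => /p_inj /eqP; rewrite eq_sym (negbTE (al_be _ _)).
Qed.

Lemma pts_be e f i : (i <= k e)%N -> (pts e i == p (be f)) = (i == k e) && (be e == be f).
Proof.
move=> ie; apply/eqP/andP => [|[/eqP-> /eqP<-]]; last exact: ptsk.
rewrite -ptsk => H.
have K : i = k e -> i == k e /\ be e == be f.
  by move=> i0; move: H; rewrite i0 !ptsk => /p_inj ->.
case: (pts_inj ie (leqnn _) H) => [[ef ik]|[[i0|/K] _]] //; first by subst f; apply: K.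
by move: H; rewrite i0 ptsk pts0 => /p_inj /eqP; rewrite (negbTE (al_be _ _)).
Qed.

Lemma pts_interior e f i j : (0 < i < k e)%N -> (j <= k f)%N ->
  (pts f j == pts e i) = (f == e) && (j == i).
Proof.
move=> /andP[i0 ik] jf; apply/eqP/andP => [|[/eqP-> /eqP->]] // H.
have [[-> ->]|[_ [] h]] := pts_inj jf (ltnW ik) H; first by [].
  by rewrite h in i0.
by rewrite h ltnn in ik.
Qed.

(** The segments of all polylines as one finite family, padded to the common
    length [N] and cut back by [P]. *)
Let N := (\max_e k e)%N.
Let I := (E * 'I_N)%type.
Let P (u : I) := (u.2 < k u.1)%N.
Let s (u : I) := pts u.1 u.2.
Let t (u : I) := pts u.1 u.2.+1.

Lemma sum_segments (F : E -> nat -> bool) :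
  \big[addb/false]_(u | P u) F u.1 u.2 =
  \big[addb/false]_e \big[addb/false]_(i < k e) F e i.
Proof.
rewrite -(pair_big_dep xpredT (fun e (i : 'I_N) => (i < k e)%N) (fun e i => F e i)) /=.
apply: eq_bigr => e _; rewrite -(big_ord_widen N (fun i => F e i)) //.
exact: leq_bigmax.
Qed.

Section Cycle.
Variable z : E -> bool.
Hypothesis z_al : forall v, \big[addb/false]_(e | al e == v) z e = false.
Hypothesis z_be : forall v, \big[addb/false]_(e | be e == v) z e = false.

Lemma telescope_xor n (h : nat -> bool) :
  \big[addb/false]_(i < n) (h i (+) h i.+1) = h 0%N (+) h n.
Proof.
elim: n => [|n IH]; first by rewrite big_ord0 addbb.
by rewrite big_ord_recr /= IH addbA addbK.
Qed.

(** Grouping by the end [g e]: a weighted sum of vertex values vanishes if the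
    weights at each vertex do. *)
Lemma star_sum (g : E -> V) (h : V -> bool) :
  (forall v, \big[addb/false]_(e | g e == v) z e = false) ->
  \big[addb/false]_e (z e && h (g e)) = false.
Proof.
move=> zg; rewrite (partition_big g xpredT) //= big1 // => v _.
under eq_bigr => e /eqP -> do rewrite andbC.
by rewrite -big_distrr /= zg andbF.
Qed.

Lemma segments_closed (h : R * R -> bool) :
  \big[addb/false]_(u | P u) (z u.1 && (h (s u) (+) h (t u))) = false.
Proof.
rewrite (sum_segments (fun e i => z e && (h (pts e i) (+) h (pts e i.+1)))).
under eq_bigr => e _ do
  rewrite -big_distrr /= (telescope_xor _ (fun i => h (pts e i))) pts0 ptsk andb_addr.
rewrite big_split /= (star_sum (fun v => h (p v)) z_al).
by rewrite (star_sum (fun v => h (p v)) z_be).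
Qed.

Let W := winding P s t (fun u => z u.1).

Lemma W_flip e i : (i < k e)%N ->
  W (pts e i) (pts e i.+1) (+) W (pts e i.+1) (pts e i) = z e.
Proof.
move=> ie; have iN : (i < N)%N by apply: leq_trans ie _; exact: leq_bigmax.
apply: (@winding_flip R I P s t (fun u => z u.1) segments_closed _ _ _ (e, Ordinal iN)) => //.
- move=> j j' x y; rewrite /P => Pj Pj'.
  by rewrite !inE => /orP[] /eqP-> /orP[] /eqP->; apply: pts_snd => //; exact: ltnW.
- move=> [f j]; rewrite /P /s /t /= => Pj; apply/eqP => H.
  have [[_]|[h1 h2]] := pts_inj (ltnW Pj) Pj H; first by lia.
  have j0 : (j = 0 :> nat)%N by lia.
  have kj : k f = 1%N by lia.
  move: H; rewrite j0 -kj pts0 ptsk => /p_inj /eqP.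
  by rewrite (negbTE (al_be _ _)).
- move=> [f j] [g l]; rewrite /P /s /t /= => Pj Pl /eqP ne; apply: pts_meet => //.
  by case=> fg jl; apply: ne; subst g; congr pair; apply/val_inj.
Qed.

(** At a bend only two segments meet, both of weight [z e], and exactly one of
    them precedes the other in the angular order: turning from one segment to the
    other passes the polyline once. *)
Lemma W_bend e i : (i.+1 < k e)%N ->
  W (pts e i.+1) (pts e i) (+) W (pts e i.+1) (pts e i.+2) = z e.
Proof.
move=> ie.
have iN : (i < N)%N by apply: leq_trans (ltnW ie) _; exact: leq_bigmax.
have iN1 : (i.+1 < N)%N by apply: leq_trans ie _; exact: leq_bigmax.
set x := pts e i.+1; set a := pts e i; set b := pts e i.+2.
have pin f j : (j <= k f)%N -> (pts f j == x) = (f == e) && (j == i.+1).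
  by move=> jf; apply: pts_interior.
rewrite /W /winding -big_split /=.
have Pi : P (e, Ordinal iN) by exact: ltnW.
have Pi1 : P (e, Ordinal iN1) by [].
rewrite (eq_bigr (fun u => ((u == (e, Ordinal iN1)) && (z u.1 && (angle_lt x (t u) a (+)
  angle_lt x (t u) b)))
          (+) ((u == (e, Ordinal iN)) && (z u.1 && (angle_lt x (s u) a (+) angle_lt x (s u)
            b))))); last first.
  move=> [f j] /= Pj; rewrite -andb_addr /before /s /t /= !pin // ?(ltnW Pj) //.
  rewrite !xpair_eqE -!val_eqE /= eqSS.
  by case: (f == e); case: (z f); case: (ray _ _ _); case: (nat_of_ord j == i.+1);
     case: (nat_of_ord j == i) => //=; do ?case: (angle_lt _ _ _).
rewrite big_split /= !xsum_only // /s /t /= -/a -/b -/x !angle_lt_irr addbF addFb -andb_addr.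
have -> : angle_lt x b a (+) angle_lt x a b; last by rewrite andbT.
have xa : x != a.
  by rewrite eq_sym /a pin ?(ltnW (ltnW ie)) // eqxx /= neq_ltn ltnSn.
have xb : x != b.
  by rewrite eq_sym /b pin // eqxx /= neq_ltn ltnSn orbT.
have m : meet_at_ends a x x b.
  by apply: pts_meet; [exact: ltnW | done | case; lia].
apply: angle_lt_total.
- by apply: contraNN xb => /eqP h; apply/eqP; apply: pts_snd h; lia.
- by apply: contraNN xa => /eqP h; apply/eqP; apply: pts_snd h; lia.
- by move=> y h1 /on_segC h2; have [h3 h4] := m y h2 h1; split; tauto.
Qed.

(** Alternately crossing a segment and turning at a bend changes the parity by
    [z e] twice, so it is constant on one side of the polyline. *)
Lemma W_chain e i : (i < k e)%N ->
  W (pts e 0) (pts e 1) = W (pts e i) (pts e i.+1).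
Proof.
elim: i => // i IH ie; rewrite IH ?(ltnW ie) //.
have := W_flip (ltnW ie); have := W_bend ie.
by case: (W (pts e i.+1) (pts e i)); case: (W _ _); case: (W _ _); case: (z e).
Qed.

Lemma W_ends e :
  W (p (al e)) (pts e 1) (+) W (p (be e)) (pts e (k e).-1) = z e.
Proof.
have kk : ((k e).-1.+1 = k e)%N by rewrite prednK ?k0.
have := @W_flip e (k e).-1; rewrite -W_chain kk // ptsk pts0; exact.
Qed.

Let c v := \big[addb/false]_(u | P u) (z u.1 && ray (p v) (s u) (t u)).

Lemma W_al e y : W (p (al e)) y = c (al e) (+)
  \big[addb/false]_(f | (al f == al e) && angle_lt (p (al e)) (pts f 1) y) z f.
Proof.
rewrite /W /winding; under eq_bigr => u _ do rewrite andb_addr.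
rewrite big_split /=; congr (_ (+) _).
rewrite (sum_segments (fun f i => z f && before (p (al e)) y (pts f i) (pts f i.+1))).
rewrite [RHS]big_mkcond /=; apply: eq_bigr => f _.
have := k0 f; case kf : (k f) => [//|n] _; rewrite big_ord_recl big1 => [|i _].
  rewrite addbF /before !pts_al ?kf //= addbF; case: (_ == _) => //=.
    by rewrite andbC; case: (angle_lt _ _ _).
  by rewrite andbF.
by rewrite /before !pts_al ?kf //= ?andbF // /bump /= ?add1n; have := ltn_ord i; lia.
Qed.

Lemma W_be e y : W (p (be e)) y = c (be e) (+)
  \big[addb/false]_(f | (be f == be e) && angle_lt (p (be e)) (pts f (k f).-1) y) z f.
Proof.
rewrite /W /winding; under eq_bigr => u _ do rewrite andb_addr.
rewrite big_split /=; congr (_ (+) _).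
rewrite (sum_segments (fun f i => z f && before (p (be e)) y (pts f i) (pts f i.+1))).
rewrite [RHS]big_mkcond /=; apply: eq_bigr => f _.
have := k0 f; case kf : (k f) => [//|n] _; rewrite big_ord_recr big1 => [|i _] /=.
  rewrite /before !pts_be ?kf // eqxx (ltn_eqF (ltnSn n)) /=; case: (_ == _) => //=.
    by rewrite andbC; case: (angle_lt _ _ _).
  by rewrite andbF.
have ii := ltn_ord i; rewrite /before !pts_be ?kf //; lia.
Qed.

Lemma winding_potential : exists c' : V -> bool, forall e,
  (c' (al e) (+) \big[addb/false]_(f | (al f == al e)
       && angle_lt (p (al e)) (pts f 1) (pts e 1)) z f) (+)
  (c' (be e) (+) \big[addb/false]_(f | (be f == be e)
       && angle_lt (p (be e)) (pts f (k f).-1) (pts e (k e).-1)) z f) = z e.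
Proof. by exists c => e; rewrite -W_al -W_be W_ends. Qed.

End Cycle.

(** The rotation at a vertex is given by the directions of the first, respectively
    last, segments of the polylines. *)
Lemma generic_polyline_bound :
  (forall e f, al e = al f -> be e = be f -> e = f) ->
  (forall e, (forall f, al f = al e -> f = e) ->
             (forall f, be f = be e -> f = e) -> False) ->
  (0 < #|E|)%N -> (#|E| + 4 <= 2 * #|V|)%N.
Proof.
move=> ends_inj lonely E0.
have km e : (k e).-1.+1 = k e by rewrite prednK.
have kle e : ((k e).-1 <= k e)%N by exact: leq_pred.
have toa x y : al x = al y -> x != y ->
    angle_lt (p (al x)) (pts x 1) (pts y 1) (+) angle_lt (p (al x)) (pts y 1) (pts x 1).
  move=> axy xy; apply: angle_lt_total.
  - rewrite -pts0; apply/eqP => /pts_snd => /(_ (leq0n _) (k0 _)) /eqP.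
    by rewrite pts0 eq_sym pts_al.
  - rewrite -pts0; apply/eqP => /pts_snd => /(_ (leq0n _) (k0 _)) /eqP.
    by rewrite pts0 eq_sym pts_al.
  - rewrite -{1}pts0 axy -pts0; apply: pts_meet => // -[e].
    by rewrite e eqxx in xy.
have tob x y : be x = be y -> x != y ->
    angle_lt (p (be x)) (pts x (k x).-1) (pts y (k y).-1) (+)
    angle_lt (p (be x)) (pts y (k y).-1) (pts x (k x).-1).
  move=> axy xy; apply: angle_lt_total.
  - rewrite -ptsk; apply/eqP => /pts_snd => /(_ (leqnn _) (kle _)) /eqP.
    by rewrite ptsk eq_sym pts_be // -{2}km -(inj_eq succn_inj) km; have := k0 x; lia.
  - rewrite -ptsk; apply/eqP => /pts_snd => /(_ (leqnn _) (kle _)) /eqP.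
    by rewrite ptsk eq_sym pts_be //; have := k0 y; lia.
  - have m := @pts_meet x y (k x).-1 (k y).-1; rewrite !km !leqnn !ptsk -axy in m.
    have ne : (x, (k x).-1) <> (y, (k y).-1) by case=> e; rewrite e eqxx in xy.
    exact: (meet_ends_sym (meet_ends_swap (meet_ends_sym (meet_ends_swap (m isT isT ne))))).
apply: (@rotation_bound E V al be
   (fun e f => angle_lt (p (al e)) (pts e 1) (pts f 1))
   (fun e f => angle_lt (p (be e)) (pts e (k e).-1) (pts f (k f).-1))) => //.
- by move=> e; exact: angle_lt_irr.
- by move=> x y z axy ayz; rewrite -axy; exact: angle_lt_trans.
- by move=> x y axy xy; have := toa x y axy xy; rewrite -axy; do 2!case: (angle_lt _ _ _).
- by move=> e; exact: angle_lt_irr.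
- by move=> x y z axy ayz; rewrite -axy; exact: angle_lt_trans.
- by move=> x y axy xy; have := tob x y axy xy; rewrite -axy; do 2!case: (angle_lt _ _ _).
move=> z za zb.
have [c cE] := winding_potential za zb.
exists c => e; rewrite -[RHS]cE; congr ((_ (+) _) (+) (_ (+) _)); apply: eq_bigl => f;
  by case: eqP => // ->.
Qed.

End Polylines.

Section Shear.
Variable R : realFieldType.
Implicit Types a b x y : (R * R)%type.

Definition shear (l : R) x : R * R := (x.1, x.2 + l * x.1).

Lemma shear_inj l : injective (shear l).
Proof. by move=> [x1 x2] [y1 y2] [-> /addIr ->]. Qed.

Lemma shear_seg l a b x : on_seg (shear l a) (shear l b) x ->
  exists2 y, x = shear l y & on_seg a b y.
Proof.
case=> t t01 ->; exists (a.1 + t * (b.1 - a.1), a.2 + t * (b.2 - a.2)).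
  by rewrite /shear /=; congr pair; ring.
by exists t.
Qed.

Lemma shear_meet l a b c d : meet_at_ends a b c d ->
  meet_at_ends (shear l a) (shear l b) (shear l c) (shear l d).
Proof.
move=> m x /shear_seg [y ->] h1 /shear_seg [y' /shear_inj <-] h2.
by have [[->|->] [->|->]] := m y h1 h2; auto.
Qed.

Lemma avoid_finite (s : seq R) : exists l, l \notin s.
Proof.
suff [l H] : exists l : R, forall x : R, x \in s -> x < l.
  by exists l; apply/negP => /H; rewrite ltxx.
elim: s => [|x s [l H]]; first by exists 0.
exists (Num.max (x + 1) l) => y; rewrite inE lt_max => /orP[/eqP->|/H ->].
  by rewrite ltrDl ltr01.
by rewrite orbT.
Qed.

(** Two distinct points get the same height for at most one value of [l]. *)
Lemma generic_shear (s : seq (R * R)) : exists l,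
  forall x y, x \in s -> y \in s -> (shear l x).2 = (shear l y).2 -> x = y.
Proof.
have [l H] := avoid_finite [seq (y.2 - x.2) / (x.1 - y.1) | x <- s, y <- s].
exists l => x y xs ys /= e.
have [e1|n1] := eqVneq x.1 y.1.
  by rewrite [x]surjective_pairing [y]surjective_pairing; congr pair => //;
     move: e; rewrite e1 => /addIr.
case/negP: H; apply/allpairsP; exists (x, y); split => //=.
have d0 : x.1 - y.1 != 0 by rewrite subr_eq0.
by apply: (mulIf d0); rewrite divfK //; lra.
Qed.

End Shear.

Lemma polyline_bound (R : realFieldType) (E V : finType) (al be : E -> V)
  (p : V -> (R * R)%type) (k : E -> nat) (pts : E -> nat -> (R * R)%type) :
  (forall e f, al e != be f) ->
  (forall e f, al e = al f -> be e = be f -> e = f) ->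
  (forall e, (forall f, al f = al e -> f = e) ->
             (forall f, be f = be e -> f = e) -> False) ->
  polyline_drawing al be p k pts ->
  (0 < #|E|)%N -> (#|E| + 4 <= 2 * #|V|)%N.
Proof.
move=> al_be inj lon [k0 p0 pk p_inj pts_inj meet] E0.
have [l H] := generic_shear
  (flatten [seq [seq pts e i | i <- iota 0 (k e).+1] | e <- enum E]).
have inL e i : (i <= k e)%N -> pts e i \in
    flatten [seq [seq pts e i | i <- iota 0 (k e).+1] | e <- enum E].
  move=> ie; apply/flatten_mapP; exists e; first by rewrite mem_enum.
  by apply: map_f; rewrite mem_iota.
apply: (@generic_polyline_bound R E V al be (shear l \o p) k
         (fun e i => shear l (pts e i))) => //.
  split=> //=.
  - by move=> e; rewrite p0.
  - by move=> e; rewrite pk.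
  - by move=> x y /shear_inj /p_inj.
  - by move=> e f i j ie jf /shear_inj; exact: pts_inj.
  - by move=> e f i j ie jf ne; apply: shear_meet; exact: meet.
by move=> e f i j ie jf h; congr shear; apply: H => //; exact: inL.
Qed.
Local Close Scope ring_scope.

(** * Simple polylines *)

Local Open Scope ring_scope.
Section SimplePolyline.
Variable R : realFieldType.
Implicit Types a b c d x y q : (R * R)%type.

Lemma on_seg_sub_right a b x y : on_seg a b x -> on_seg a x y -> on_seg a b y.
Proof.
case=> t t01 -> [u u01 ->] /=; exists (u * t); last by congr pair; ring.
by case/andP: t01 => t0 t1; case/andP: u01 => u0 u1; rewrite mulr_ge0 //= mulr_ile1.
Qed.

Lemma on_seg_sub_left a b x y : on_seg a b x -> on_seg x b y -> on_seg a b y.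
Proof.
move=> /on_segC h1 /on_segC h2; exact/on_segC/(on_seg_sub_right h1).
Qed.

(** If two consecutive segments meet outside their common end [b], they leave [b]
    in the same direction, so [ac] is covered by them. *)
Lemma on_seg_fold a b c x y : on_seg a b x -> on_seg b c x -> x <> b ->
  on_seg a c y -> on_seg a b y \/ on_seg b c y.
Proof.
move=> /on_segC[t t01 xt] [t' t01' xt'] xb [u u01 ->].
have t0 : 0 < t.
  rewrite lt_def; case/andP: t01 => -> _; rewrite andbT; apply/eqP => t0.
  by apply: xb; rewrite xt t0 !mul0r !addr0 -surjective_pairing.
have t0' : 0 < t'.
  rewrite lt_def; case/andP: t01' => -> _; rewrite andbT; apply/eqP => t0'.
  by apply: xb; rewrite xt' t0' !mul0r !addr0 -surjective_pairing.
have [e1 e2] : t * (a.1 - b.1) = t' * (c.1 - b.1) /\ t * (a.2 - b.2) = t' * (c.2 - b.2).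
  by move: xt; rewrite xt' => -[/addrI -> /addrI ->].
pose k := t / t'.
have k0 : 0 < k by exact: divr_gt0.
have f1 : c.1 = b.1 + k * (a.1 - b.1).
  by rewrite /k mulrAC e1 mulrAC mulfV ?gt_eqF // mul1r addrC subrK.
have f2 : c.2 = b.2 + k * (a.2 - b.2).
  by rewrite /k mulrAC e2 mulrAC mulfV ?gt_eqF // mul1r addrC subrK.
case/andP: u01 => u0 u1.
pose w := (1 - u) + u * k.
have w0 : 0 <= w by rewrite addr_ge0 ?subr_ge0 // mulr_ge0 // ltW.
have g1 : a.1 + u * (c.1 - a.1) = b.1 + w * (a.1 - b.1) by rewrite f1 /w; ring.
have g2 : a.2 + u * (c.2 - a.2) = b.2 + w * (a.2 - b.2) by rewrite f2 /w; ring.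
rewrite g1 g2; case: (leP w 1) => [w1|w1].
  by left; apply: on_segC; exists w => //; rewrite w0.
right; exists (w / k).
  apply/andP; split; first by apply: divr_ge0 => //; exact: ltW.
  rewrite ler_pdivrMr // mul1r.
  have k1 : 1 < k.
    rewrite ltNge; apply/negP => k1; have : u * (k - 1) <= 0.
      by rewrite mulr_ge0_le0 // subr_le0.
    by rewrite /w in w1; lra.
  have : (1 - u) * (1 - k) <= 0 by rewrite mulr_ge0_le0 ?subr_ge0 // subr_le0 ltW.
  rewrite /w; lra.
have kn : k != 0 by rewrite gt_eqF.
by rewrite f1 f2 /=; congr pair; field.
Qed.

Variable U : set (R * R).

Definition seg_in a b : bool := `[< forall x, on_seg a b x -> U x >].

Lemma seg_in_sub a b c d : (forall x, on_seg c d x -> on_seg a b x) ->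
  seg_in a b -> seg_in c d.
Proof. by move=> h /asboolP ab; apply/asboolP => x /h /ab. Qed.

Definition joined a b : Prop := exists2 s, path seg_in a s & last a s = b.

Lemma joined_refl a : joined a a.
Proof. by exists [::]. Qed.

Lemma joined_trans a b c : joined a b -> joined b c -> joined a c.
Proof.
move=> [s1 p1 l1] [s2 p2 l2]; exists (s1 ++ s2); first by rewrite cat_path p1 l1.
by rewrite last_cat l1.
Qed.

Lemma joined_seg a b : (forall x, on_seg a b x -> U x) -> joined a b.
Proof. by move=> h; exists [:: b] => //=; rewrite andbT; apply/asboolP. Qed.

(** A polyline inside [U] with the least number of segments is simple: a repeated
    node, a crossing or a fold would allow a shortcut made of points of the
    polyline itself, hence still inside [U]. *)
Lemma simple_polyline a b : a <> b -> joined a b ->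
  exists k (f : nat -> R * R),
    [/\ (0 < k)%N, f 0%N = a, f k = b &
    [/\ forall i, (i < k)%N -> forall x, on_seg (f i) (f i.+1) x -> U x,
        forall i j, (i <= k)%N -> (j <= k)%N -> f i = f j -> i = j
      & forall i j, (i < k)%N -> (j < k)%N -> i <> j ->
          meet_at_ends (f i) (f i.+1) (f j) (f j.+1)]].
Proof.
move=> ab [s0 p0 l0].
have ex : exists n, `[< exists s, [/\ size s = n, path seg_in a s & last a s = b] >].
  by exists (size s0); apply/asboolP; exists s0.
case: (ex_minnP ex) => k /asboolP[s [sk ps ls]] kmin.
have mins s' : path seg_in a s' -> last a s' = b -> (k <= size s')%N.
  by move=> p' l'; apply: kmin; apply/asboolP; exists s'.
pose f i := nth a (a :: s) i.
have last_take i : (i <= k)%N -> last a (take i s) = f i.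
  move=> ik; rewrite /f (last_nth a) size_takel ?sk //.
  by case: i ik => // i ik /=; rewrite nth_take.
have path_take i : path seg_in a (take i s).
  by have := ps; rewrite -{1}(cat_take_drop i s) cat_path => /andP[].
have path_drop i : (i <= k)%N -> path seg_in (f i) (drop i s).
  by move=> ik; have := ps; rewrite -{1}(cat_take_drop i s) cat_path last_take // => /andP[].
have last_drop i : (i <= k)%N -> last (f i) (drop i s) = b.
  by move=> ik; rewrite -ls -{2}(cat_take_drop i s) last_cat last_take.
have fS i : (i < k)%N -> drop i s = f i.+1 :: drop i.+1 s.
  by move=> ik; rewrite /f /= -drop_nth ?sk.
have seg i : (i < k)%N -> seg_in (f i) (f i.+1).
  by move=> ik; have := path_drop i (ltnW ik); rewrite fS //= => /andP[].
have k0 : (0 < k)%N.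
  by rewrite lt0n; apply/eqP => k0; apply: ab; move: ls sk; rewrite k0; case: (s).
have f_lt i j : (i < j)%N -> (j <= k)%N -> f i <> f j.
  move=> ij jk fij; have ik : (i <= k)%N by lia.
  have := mins (take i s ++ drop j s).
  rewrite cat_path path_take last_take // fij path_drop // last_cat last_take // fij.
  rewrite last_drop // size_cat size_takel ?sk // size_drop sk => /(_ isT erefl).
  by lia.
have m_lt i j : (i < j)%N -> (j < k)%N -> meet_at_ends (f i) (f i.+1) (f j) (f j.+1).
  move=> ij jk x xi xj; have ik : (i < k)%N by lia.
  have seg1 : seg_in (f i) x.
    by apply: seg_in_sub (seg i ik) => y; exact: on_seg_sub_right.
  have seg2 : seg_in x (f j.+1).
    by apply: seg_in_sub (seg j jk) => y; exact: on_seg_sub_left.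
  have /andP[segj pj] : seg_in (f j) (f j.+1) && path seg_in (f j.+1) (drop j.+1 s).
    by have := path_drop j (ltnW jk); rewrite fS.
  have lj := last_drop j.+1 jk.
  have : (k <= i + (k - j).+1)%N.
    have := mins (take i s ++ x :: drop j s).
    rewrite size_cat size_takel ?sk ?(ltnW ik) //= size_drop sk; apply.
      by rewrite cat_path path_take last_take ?(ltnW ik) //= seg1 fS //= seg2.
    by rewrite last_cat /= fS.
  move=> kle; have {kle}ji : j = i.+1 by lia.
  subst j; have [->|/eqP xn] := eqVneq x (f i.+1); first by auto.
  have sk2 : seg_in (f i) (f i.+2).
    apply/asboolP => y yi; have /asboolP si := seg i ik; have /asboolP si1 := seg i.+1 jk.
    by have [/si|/si1] := on_seg_fold xi xj xn yi.
  have := mins (take i s ++ drop i.+1 s).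
  rewrite size_cat size_takel ?sk ?(ltnW ik) // size_drop sk => H.
  have : (k <= i + (k - i.+1))%N; last by lia.
  apply: H; last by rewrite last_cat fS.
  by rewrite cat_path path_take last_take ?(ltnW ik) // fS //= sk2.
exists k, f; split=> //; first by rewrite -last_take // -sk take_size.
split=> [i ik x|i j ik jk|i j ik jk ne].
- by have /asboolP := seg i ik; exact.
- by have [h|h|//] := ltngtP i j => e; [case: (f_lt i j) | case: (f_lt j i)].
- have [h|h|//] := ltngtP i j; first exact: m_lt.
  exact/meet_ends_sym/m_lt.
Qed.

End SimplePolyline.
Local Close Scope ring_scope.

(** * Arcs in the plane *)

Local Open Scope classical_set_scope.
Local Open Scope ring_scope.
Section Topology.
Variable R : realType.

Lemma clamp_dist (x u : R) :
  `|Num.max 0 (Num.min 1 x) - Num.max 0 (Num.min 1 u)| <= `|x - u|.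
Proof.
have h1 : x - u <= `|x - u| by exact: ler_norm.
have h2 : u - x <= `|x - u| by rewrite distrC; exact: ler_norm.
have h3 := normr_ge0 (x - u); set N := `|x - u| in h1 h2 h3 *.
rewrite ler_norml; case: (leP 1 x) => hx; case: (leP 1 u) => hu.
- by rewrite subrr; lra.
- by case: (leP 0 1); case: (leP 0 u) => *; lra.
- by case: (leP 0 1); case: (leP 0 x) => *; lra.
- by case: (leP 0 x); case: (leP 0 u) => *; lra.
Qed.

(** Extending an arc by constants to the whole line turns continuity within
    [[0, 1]] into continuity. *)
Lemma clamp_continuous (V : normedModType R) (f : R -> V) :
  {within `[0, 1], continuous f} ->
  continuous (fun u : R => f (Num.max 0 (Num.min 1 u))).
Proof.
move=> /subspace_continuousP cf.
pose c (u : R) : R := Num.max 0 (Num.min 1 u).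
move=> x; change (f \o c @ x --> f (c x)).
have c01 u : `[0, 1]%classic (c u).
  by rewrite /= in_itv /= /c le_max lexx ge_max ler01 ge_min lexx.
apply: (@cvg_comp _ _ _ c f _ (within `[0, 1] (nbhs (c x)))); last exact: cf (c01 x).
suff cc : c @ x --> c x.
  move=> W hW; have := cc _ hW; rewrite /= !nbhs_simpl /=.
  by apply: filterS => u /=; apply; exact: c01.
apply/cvgrPdist_lt => e e0; near=> u.
have : ball x e u by (near: u; apply: (@nbhsx_ballx R R)).
rewrite -ball_normE /= => xu; apply: le_lt_trans xu; rewrite /c.
exact: clamp_dist.
Unshelve. all: end_near. Qed.

(** Disjoint compact and closed sets are at positive distance; the conclusion is
    stated with [\near] so that finitely many such gaps combine. *)
Lemma compact_closed_gap (V : normedModType R) (K C : set V) : compact K -> closed C ->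
  (forall x, K x -> ~ C x) ->
  \forall d \near 0^'+, forall x y, K x -> C y -> d < `|x - y|.
Proof.
move=> /compact_near_coveringP cK cC KC.
have := cK R (0^'+) (fun d x => forall y, C y -> d < `|x - y|) _.
suff H : forall x, K x -> \forall x' \near x & d \near 0^'+, forall y, C y -> d < `|x' - y|.
  by move=> /(_ _ H); apply: filterS => d Hd x y Kx Cy; exact: Hd.
move=> x Kx.
have : nbhs x (~` C) by apply: open_nbhs_nbhs; split; [exact: closed_openC | exact: KC].
move=> /nbhs_ballP [e /= e0 eC].
near=> x' d => y Cy.
have : e <= `|x - y|.
  by rewrite leNgt; apply/negP => h; apply: (eC y) => //; rewrite -ball_normE.
have h1 : `|x - x'| < e / 2.
  have : ball x (e / 2) x' by near: x'; apply: nbhsx_ballx; lra.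
  by rewrite -ball_normE.
have h2 : d < e / 2 by near: d; apply: nbhs_right_lt; lra.
have := ler_distD x' x y => /=; lra.
Unshelve. all: end_near. Qed.

(** The last parameter in the closed ball exists by compactness and lies on the
    sphere by continuity. *)
Lemma last_visit (V : normedModType R) (g : R -> V) (c : V) (r s t : R) :
  continuous g -> s <= t -> `|g s - c| <= r -> r < `|g t - c| ->
  exists u, [/\ s <= u < t, `|g u - c| = r
    & forall v, u < v <= t -> r < `|g v - c|].
Proof.
move=> cg st gs gt.
have cn : continuous (fun u => `|g u - c|).
  move=> u; apply: (@continuous_comp _ _ _ (fun u => g u - c) (fun x => `|x|)).
    by apply: continuousB; [exact: cg | exact: cst_continuous].
  exact: norm_continuous.
pose A := `[s, t] `&` (fun u => `|g u - c|) @^-1` [set x | x <= r].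
have cA : compact A.
  apply: compact_closedI; first exact: segment_compact.
  by apply: closed_comp => [u _|]; [exact: cn | exact: closed_le].
have A0 : A !=set0 by exists s; split => //=; rewrite in_itv /= lexx.
have cid : {within A, continuous (@id R)} by apply: continuous_subspaceT => u; exact: cvg_id.
have [u /set_mem[/= + gu] umax] := compact_EVT_max A0 cA cid.
rewrite in_itv /= => /andP[su ut].
have ut' : u < t by rewrite lt_neqAle ut andbT; apply/eqP => e; move: gu; rewrite e; lra.
have out v : u < v <= t -> r < `|g v - c|.
  move=> /andP[uv vt]; rewrite ltNge; apply/negP => gv.
  have : v \in A by apply/mem_set; split => //=; rewrite in_itv /=; lra.
  by move=> /umax; lra.
exists u; split => //; first by rewrite su.
apply/eqP; rewrite eq_le gu /= leNgt; apply/negP => lt.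
have : \forall v \near u, `|g v - c| < r.
  have /cvgrPdist_lt /(_ (r - `|g u - c|)) := cn u; rewrite subr_gt0 => /(_ lt).
  apply: filterS => v; rewrite distrC => h; have := ler_norm (`|g v - c| - `|g u - c|); lra.
move=> /nbhs_ballP [e /= e0 eb].
pose v := Num.min t (u + e / 2).
have uv : u < v by rewrite /v lt_min ut' /=; lra.
have ve : v <= u + e / 2 by rewrite /v ge_min lexx orbT.
have := eb v; rewrite -ball_normE /= => /(_ _).
have -> : `|u - v| < e by rewrite ltr0_norm; lra.
have := out v; rewrite uv /v ge_min lexx /= => /(_ isT) h1 /(_ isT) h2; lra.
Qed.

Lemma on_seg_near (x y z : R * R) e : ball x e y -> on_seg x y z -> ball x e z.
Proof.
rewrite -ball_normE /= => xy [t /andP[t0 t1] ->].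
apply: le_lt_trans xy; rewrite !prod_normE /=.
rewrite ge_max !le_max; apply/andP; split; apply/orP; [left|right].
  rewrite opprD addrA subrr add0r normrN normrM (ger0_norm t0) distrC.
  by rewrite ler_piMl.
rewrite opprD addrA subrr add0r normrN normrM (ger0_norm t0) distrC.
by rewrite ler_piMl.
Qed.

(** The parameters that a polyline inside [O] can reach form an open subset of the
    interval, and so do the others, since balls are convex; the interval is
    connected. *)
Lemma joined_open (O : set (R * R)) (g : R -> R * R) s t : open O -> continuous g ->
  s <= t -> (forall u, s <= u <= t -> O (g u)) -> joined O (g s) (g t).
Proof.
move=> oO cg st Og.
pose J u := joined O (g s) (g u).
have oOg : open (g @^-1` O) by apply: open_comp => // u _; exact: cg.
have step u : O (g u) -> \forall v \near u, J u <-> J v.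
  move=> Ou.
  have /nbhs_ballP [e /= e0 eO] : nbhs (g u) O by apply: open_nbhs_nbhs.
  have : \forall v \near u, ball (g u) e (g v) by apply: (cg u); exact: nbhsx_ballx.
  apply: filterS => v gv.
  have sg x : on_seg (g u) (g v) x -> O x by move=> h; apply: eO; exact: on_seg_near gv h.
  split => h; apply: joined_trans h _; apply: joined_seg => // x /on_segC; exact: sg.
pose O1 := [set u | O (g u) /\ J u].
pose O2 := [set u | O (g u) /\ ~ J u].
have oO1 : open O1.
  rewrite openE => u [Ou Ju]; have nO : nbhs u (g @^-1` O) by apply: open_nbhs_nbhs.
  by apply: filterS2 nO (step u Ou) => v Ov [h _]; split => //; exact: h.
have oO2 : open O2.
  rewrite openE => u [Ou Ju]; have nO : nbhs u (g @^-1` O) by apply: open_nbhs_nbhs.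
  by apply: filterS2 nO (step u Ou) => v Ov [_ h]; split => // /h.
have n0 : `[s, t] `&` O1 !=set0.
  exists s; split; first by rewrite /= in_itv /= lexx.
  by split; [apply: Og; rewrite lexx | exact: joined_refl].
have sub1 : exists2 C, open C & `[s, t] `&` O1 = `[s, t] `&` C by exists O1.
have sub2 : exists2 C, closed C & `[s, t] `&` O1 = `[s, t] `&` C.
  exists (~` O2); first exact: open_closedC.
  apply/seteqP; split=> u [ust]; last first.
    move=> nO2; split => //; have Ou : O (g u).
      by apply: Og; move: ust; rewrite /= in_itv.
    by split => //; apply: contrapT => nJ; apply: nO2.
  by move=> [_ Ju]; split => // -[].
have E := @segment_connected R s t _ n0 sub1 sub2.
have : (`[s, t] `&` O1) t by rewrite E /= in_itv /= st lexx.
by case=> _ [].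
Qed.

End Topology.

Section Arcs.
Variable R : realType.

Lemma joined_sub (U U' : set (R * R)) a b : U `<=` U' -> joined U a b -> joined U' a b.
Proof.
move=> UU' [s p l]; exists s => //; apply: sub_path p => x y /asboolP h.
by apply/asboolP => z /h /UU'.
Qed.

(** The middle part [M] of an arc runs from the last exit [q] from the disc around
    [a] to the first entry [q'] into the disc around [b] after that.  The order
    of the two choices matters: before [q] the arc may have visited both discs
    several times. *)
Lemma arc_middle (a b : R * R) (A : set (R * R)) (r : R) : is_arc a b A -> 0 < r ->
  2 * r < `|a - b| ->
  exists M q q', [/\ compact M, M `<=` A, `|q - a| = r, `|q' - b| = r &
    [/\ forall m, M m -> `|m - a| <= r -> m = q,
        forall m, M m -> `|m - b| <= r -> m = q',
        M q, M q'
      & forall O, open O -> M `<=` O -> joined O q q']].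
Proof.
move=> [f [cf _ f0 f1 fA]] r0 ab.
pose g (u : R) := f (Num.max 0 (Num.min 1 u)).
have cg : continuous g by exact: clamp_continuous.
have gf u : 0 <= u <= 1 -> g u = f u.
  move=> /andP[u0 u1]; rewrite /g; congr f.
  by case: (leP 1 u) => h; [have -> : u = 1 by lra|]; case: leP => //; lra.
have g0 : g 0 = a by rewrite gf ?f0 //; lra.
have g1 : g 1 = b by rewrite gf ?f1 //; lra.
have [u0 [/andP[u00 u01] ru0 out0]] : exists u, [/\ 0 <= u < 1, `|g u - a| = r
    & forall v, u < v <= 1 -> r < `|g v - a|].
  apply: last_visit => //; rewrite ?g0 ?g1 ?subrr ?normr0; try lra.
  by rewrite distrC; lra.
pose g' u := g (- u).
have cg' : continuous g'.
  move=> u; apply: continuous_comp; first exact: opp_continuous.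
  exact: cg.
have [w [/andP[w0 w1] rw out1]] : exists u, [/\ -1 <= u < - u0, `|g' u - b| = r
    & forall v, u < v <= - u0 -> r < `|g' v - b|].
  apply: last_visit => //; rewrite /g' ?opprK ?g1 ?subrr ?normr0; try lra.
  by have := ler_distD (g u0) a b; rewrite (distrC a (g u0)) ru0; lra.
pose M := g @` `[u0, - w].
exists M, (g u0), (g (- w)); split => //.
- by apply: continuous_compact; [exact: continuous_subspaceT | exact: segment_compact].
- move=> _ [u + <-]; rewrite /= in_itv /= => /andP[h1 h2]; rewrite -fA; exists u.
    by rewrite /= in_itv /=; lra.
  by rewrite gf //; lra.
split.
- move=> _ [u + <-]; rewrite /= in_itv /= => /andP[h1 h2] h; congr g.
  apply/eqP; rewrite eq_le h1 andbT leNgt; apply/negP => h3.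
  have u1 : u <= 1 by lra.
  by have := out0 u; rewrite h3 u1 => /(_ isT); lra.
- move=> _ [u + <-]; rewrite /= in_itv /= => /andP[h1 h2] h; congr g.
  apply/eqP; rewrite eq_le h2 /= leNgt; apply/negP => h3.
  have wu : w < - u <= - u0 by lra.
  by have := out1 _ wu; rewrite /g' opprK; lra.
- by exists u0 => //; rewrite /= in_itv /=; lra.
- by exists (- w) => //; rewrite /= in_itv /=; lra.
- move=> O oO MO; apply: joined_open => // [|u hu]; first by lra.
  by apply: MO; exists u => //; rewrite /= in_itv.
Qed.

Lemma affine_continuous (V : normedModType R) (a b : V) :
  continuous (fun t : R => a + t *: b).
Proof.
by move=> t; apply: cvgD; [exact: cvg_cst | apply: cvgZr_tmp; exact: cvg_id].
Qed.

Lemma on_seg_compact (a b : R * R) : compact [set x | on_seg a b x].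
Proof.
have -> : [set x | on_seg a b x] = (fun t : R => a + t *: (b - a)) @` `[0, 1].
  apply/seteqP; split=> x [t t01 e]; exists t.
  - by rewrite /= in_itv.
  - by rewrite e.
  - by move: t01; rewrite /= in_itv.
  - by rewrite -e.
apply: continuous_compact; last exact: segment_compact.
by apply: continuous_subspaceT; exact: affine_continuous.
Qed.

Lemma on_seg_closed (a b : R * R) : closed [set x | on_seg a b x].
Proof. by apply: compact_closed; [exact: norm_hausdorff | exact: on_seg_compact]. Qed.

Lemma on_seg_norm (a b x : R * R) : on_seg a b x ->
  exists2 t, 0 <= t <= 1 & x = a + t *: (b - a) /\ `|x - a| = t * `|b - a|.
Proof.
case=> t t01 e; exists t => //; have ex : x = a + t *: (b - a) by rewrite e.
split => //; rewrite ex addrC addKr normrZ ger0_norm //.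
by case/andP: t01.
Qed.

Lemma on_seg_end (a b x : R * R) r : 0 < r -> `|b - a| = r -> on_seg a b x ->
  `|x - a| <= r /\ (`|x - a| = r -> x = b).
Proof.
move=> r0 br /on_seg_norm [t /andP[t0 t1] [-> ->]]; rewrite br; split.
  by rewrite ler_piMl // ltW.
move=> h; have -> : t = 1 by apply: (mulIf (lt0r_neq0 r0)); rewrite h mul1r.
by rewrite scale1r addrC subrK.
Qed.

(** A point of a radius is determined by its distance to the centre, so a common
    point has the same parameter on both radii. *)
Lemma on_seg_radii (a b b' x : R * R) r : 0 < r -> `|b - a| = r -> `|b' - a| = r ->
  b <> b' -> on_seg a b x -> on_seg a b' x -> x = a.
Proof.
move=> r0 br br' bb /on_seg_norm [t t01 [e1 n1]] /on_seg_norm [t' t01' [e2 n2]].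
have tt : t = t' by apply: (mulIf (lt0r_neq0 r0)); rewrite -{1}br -br' -n1 -n2.
have [t0|t0] := eqVneq t 0; first by rewrite e1 t0 scale0r addr0.
case: bb; move: e2; rewrite e1 -tt => /addrI /(scalerI t0).
by move/addIr.
Qed.

End Arcs.
Local Close Scope ring_scope.
Local Close Scope classical_set_scope.

(** * Replacing arcs by polylines *)

Local Open Scope classical_set_scope.
Local Open Scope ring_scope.
Section DrawingBound.
Variables (R : realType) (G : sgraph) (col : G -> bool).
Variables (p : G -> R * R) (arc : G -> G -> set (R * R)).
Hypothesis draw : is_drawing p arc.
Hypothesis col_adj : forall x y, adj x y -> col x != col y.

Definition bedge := {e : G * G | adj e.1 e.2 && ~~ col e.1}.
Implicit Types e f : bedge.
Let al (e : bedge) := (val e).1.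
Let be (e : bedge) := (val e).2.
Let ends (e : bedge) v := (v == al e) || (v == be e).

Let bedge_adj e : adj (al e) (be e).
Proof. by case/andP: (valP e). Qed.

Let col_al e : col (al e) = false.
Proof. by case/andP: (valP e) => _ /negbTE. Qed.

Let col_be e : col (be e) = true.
Proof. by have := col_adj (bedge_adj e); rewrite col_al; case: (col _). Qed.

Let al_be e f : al e != be f.
Proof. by apply/eqP => h; have := col_be f; rewrite -h col_al. Qed.

Let ends_inj e f : al e = al f -> be e = be f -> e = f.
Proof.
by move=> h1 h2; apply/val_inj; rewrite [val e]surjective_pairing [val f]surjective_pairing
  -/(al e) -/(be e) h1 h2.
Qed.

Let earc e := arc (al e) (be e).

Lemma arc_closed x y : adj x y -> closed (arc x y).
Proof.
move=> xy; have [f [cf _ _ _ <-]] := drawing_arc draw xy.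
apply: compact_closed; first exact: norm_hausdorff.
by apply: continuous_compact => //; exact: segment_compact.
Qed.

Lemma earc_meet e f z : e <> f -> earc e z -> earc f z ->
  exists v, [/\ ends e v, ends f v & z = p v].
Proof.
move=> ef ze zf.
have ne : [set al e; be e] <> [set al f; be f].
  move=> h; apply: ef; have he : [set al e; be e] (al e) by left.
  have he' : [set al e; be e] (be e) by right.
  rewrite h in he he'; apply: ends_inj.
    by case: he => // he; have := al_be e f; rewrite he eqxx.
  by case: he' => // he'; have := al_be f e; rewrite he' eqxx.
have [v [h1 h2] <-] := drawing_no_crossing draw (bedge_adj e) (bedge_adj f) ne (conj ze zf).
by exists v; split => //; rewrite /ends; [case: h1 | case: h2] => ->; rewrite eqxx ?orbT.
Qed.

(** These are finitely many conditions, and each holds for all small [r]: an arc is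
    compact and avoids the vertices other than its ends. *)
Lemma clearance : exists2 r : R, 0 < r &
  (forall v w, v <> w -> 2 * r < `|p v - p w|) /\
  (forall e v z, ~~ ends e v -> earc e z -> r < `|z - p v|).
Proof.
have : \forall r \near (0 : R)^'+, [/\ 0 < r,
    forall v w, v <> w -> 2 * r < `|p v - p w| &
    forall e v, ~~ ends e v -> forall z, earc e z -> r < `|z - p v|].
  near=> r; split.
  - by near: r; exact: nbhs_right_gt.
  - near: r; apply: filter_forall => v; apply: filter_forall => w.
    have [->|vw] := eqVneq v w; first by near=> r.
    have d0 : 0 < `|p v - p w|.
      by rewrite normr_gt0 subr_eq0; apply: contraNN vw => /eqP /(drawing_vertex_inj draw) ->.
    have d2 : 0 < `|p v - p w| / 2 by lra.
    by apply: filterS (nbhs_right_lt d2) => r hr _; lra.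
  - near: r; apply: filter_forall => e.
    apply: filter_forall => v.
    have [_|nv] := boolP (ends e v); first by near=> r.
    have := @compact_closed_gap R _ [set p v] (earc e) (@compact_set1 _ (p v)) (arc_closed
      (bedge_adj e)).
    move=> H; have {}H : \forall d \near 0^'+, forall x y, [set p v] x -> earc e y -> d < `|x -
      y|.
      apply: H => x -> hz; case/norP: nv => /eqP h1 /eqP h2.
      by case: (drawing_vertex_arc draw (bedge_adj e) hz).
    by apply: filterS H => r H _ z hz; rewrite distrC; exact: H.
move=> /filter_ex [r [r0 h1 h2]]; exists r => //; split => // e v z he; exact: h2.
Unshelve. all: end_near. Qed.

(** The polyline of an edge [e] is chosen inside [U e], the union of its two radii
    and of a neighbourhood [O e] of the middle part of its arc; [UU] shows that
    for distinct edges these sets share at most common end vertices.  Minimum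
    degree two excludes isolated edges, for which [polyline_bound] fails. *)
Lemma drawing_bound : (forall x : G, exists y z, [/\ y <> z, adj x y & adj x z]) ->
  (0 < #|{: bedge}|)%N -> (#|{: bedge}| + 4 <= 2 * #|G|)%N.
Proof.
move=> deg2 E0.
have [r r0 [rv ra]] := clearance.
(* [MQ.1] is the middle part and [MQ.2] gives the exit point at each end. *)
have mid e : exists MQ : set (R * R) * (G -> R * R),
  [/\ compact MQ.1, MQ.1 `<=` earc e,
      forall v, ends e v -> `|MQ.2 v - p v| = r /\ MQ.1 (MQ.2 v),
      forall v m, ends e v -> MQ.1 m -> `|m - p v| <= r -> m = MQ.2 v
    & forall O, open O -> MQ.1 `<=` O -> joined O (MQ.2 (al e)) (MQ.2 (be e))].
  have nab : 2 * r < `|p (al e) - p (be e)|.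
    by apply: rv => h; have := al_be e e; rewrite h eqxx.
  have [M [q [q' [cM Ma qr qr' [h1 h2 Mq Mq' jo]]]]] :=
    arc_middle (drawing_arc draw (bedge_adj e)) r0 nab.
  have ba : (be e == al e) = false by rewrite eq_sym; exact: negbTE (al_be e e).
  exists (M, fun v => if v == al e then q else q'); split => //=.
  - by move=> v /orP[] /eqP->; rewrite ?eqxx ?ba.
  - by move=> v m /orP[] /eqP->; rewrite ?eqxx ?ba; [exact: h1 | exact: h2].
  - by move=> O oO MO; rewrite eqxx ba; exact: jo.
have [MQ MQP] := choice mid.
pose M e := (MQ e).1; pose Q e v := (MQ e).2 v.
have cM e : compact (M e) by case: (MQP e).
have Marc e z : M e z -> earc e z by case: (MQP e) => _ h _ _ _; exact: h.
have Qr e v : ends e v -> `|Q e v - p v| = r by case: (MQP e) => _ _ h _ _ /h[].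
have MQe e v : ends e v -> M e (Q e v) by case: (MQP e) => _ _ h _ _ /h[].
have Mexit e v z : ends e v -> M e z -> `|z - p v| <= r -> z = Q e v.
  by case: (MQP e) => _ _ _ h _; exact: h.
have Mvert e v : ~ M e (p v).
  move=> Mv; have [ev|nev] := boolP (ends e v).
    have : p v = Q e v by apply: Mexit => //; rewrite subrr normr0 ltW.
    by move=> h; have := Qr e v ev; rewrite -h subrr normr0; lra.
  by have := ra e v _ nev (Marc _ _ Mv); rewrite subrr normr0; lra.
have MM e f z : e <> f -> M e z -> M f z -> False.
  move=> ef Me Mf; have [v [_ _ zv]] := earc_meet ef (Marc _ _ Me) (Marc _ _ Mf).
  by apply: (@Mvert e v); rewrite -zv.
have Mrad e f v z : e <> f -> ends f v -> M e z -> on_seg (p v) (Q f v) z -> False.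
  move=> ef fv Me zs; have [zr zq] := on_seg_end r0 (Qr _ _ fv) zs.
  have [ev|nev] := boolP (ends e v); last first.
    by have := ra e v z nev (Marc _ _ Me); lra.
  have zQ : z = Q e v by exact: Mexit.
  apply: (MM e f z) => //; rewrite zq; first exact: MQe.
  by rewrite zQ Qr.
(* One distance [d] separates the middle part of each edge from the middle parts
   and the radii of the other edges, and from all vertices, written as degenerate
   segments.  Balls of radius [d / 2] then keep the neighbourhoods disjoint. *)
have [d d0 [dMM dMr dMv]] : exists2 d : R, 0 < d & [/\
   forall e f, e <> f -> forall x y, M e x -> M f y -> d < `|x - y|,
   forall e f v, e <> f -> ends f v -> forall x y, M e x -> on_seg (p v) (Q f v) y -> d < `|x - y|
   & forall e v x y, M e x -> on_seg (p v) (p v) y -> d < `|x - y|].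
  suff : \forall d \near (0 : R)^'+, [/\ 0 < d,
   forall e f, e <> f -> forall x y, M e x -> M f y -> d < `|x - y|,
   forall e f v, e <> f -> ends f v -> forall x y, M e x -> on_seg (p v) (Q f v) y -> d < `|x - y|
   & forall e v x y, M e x -> on_seg (p v) (p v) y -> d < `|x - y|].
    by move=> /filter_ex [d [d0 h1 h2 h3]]; exists d.
  near=> d; split.
  - by near: d; exact: nbhs_right_gt.
  - near: d; apply: filter_forall => e; apply: filter_forall => f.
    have [->|/eqP ef] := eqVneq e f; first by near=> d.
    have := @compact_closed_gap R _ (M e) (M f) (cM e).
    have clM : closed (M f) by apply: compact_closed => //; exact: norm_hausdorff.
    move=> /(_ clM) H; have {}H := H (fun x h => MM e f x ef h).
    by apply: filterS H => d H _.
  - near: d; apply: filter_forall => e; apply: filter_forall => f; apply: filter_forall => v.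
    have [->|/eqP ef] := eqVneq e f; first by near=> d.
    have [fv|nfv] := boolP (ends f v); last by near=> d.
    have H := compact_closed_gap (cM e) (@on_seg_closed R (p v) (Q f v)) (fun x h => Mrad e f v
      x ef fv h).
    by apply: filterS H => d H _ _.
  - near: d; apply: filter_forall => e; apply: filter_forall => v.
    apply: compact_closed_gap => //; first exact: on_seg_closed.
    move=> x Mx [t _ xe]; apply: (@Mvert e v); rewrite [p v]surjective_pairing.
    by move: Mx; rewrite xe !subrr !mulr0 !addr0.
pose O e := [set x | exists2 y, M e y & `|x - y| < d / 2].
have oO e : open (O e).
  rewrite openE => x [y My hy]; apply/nbhs_ballP.
  exists (d / 2 - `|x - y|) => /=; first by rewrite subr_gt0.
  move=> z; rewrite -ball_normE /= => hz; exists y => //.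
  by have := ler_distD x z y; rewrite (distrC z x); lra.
have MO e : M e `<=` O e by move=> x Mx; exists x => //; rewrite subrr normr0; lra.
pose U e := [set z | O e z \/ exists2 v, ends e v & on_seg (p v) (Q e v) z].
have Uvert e v : U e (p v) -> ends e v.
  case=> [[y My hy]|[w ew h]].
    by have := dMv e v y _ My (on_seg_left _ _); rewrite distrC; lra.
  have [h1 _] := on_seg_end r0 (Qr _ _ ew) h.
  have [->//|/eqP vw] := eqVneq v w.
  by have := rv _ _ vw; lra.
have UU e f z : e <> f -> U e z -> U f z -> exists2 v, ends e v /\ ends f v & z = p v.
  move=> ef; case=> [[y My hy]|[v ev hv]] [[y' My' hy']|[w fw hw]].
  - by have := dMM e f ef y y' My My'; have := ler_distD z y y'; rewrite (distrC y z); lra.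
  - by have := dMr e f w ef fw y z My hw; rewrite distrC; lra.
  - by have := dMr f e v (nesym ef) ev y' z My' hv; rewrite distrC; lra.
  - have [zv _] := on_seg_end r0 (Qr _ _ ev) hv.
    have [zw _] := on_seg_end r0 (Qr _ _ fw) hw.
    have vw : v = w.
      apply: contrapT => vw; have := rv _ _ vw; have := ler_distD z (p v) (p w).
      by rewrite (distrC (p v) z); lra.
    subst w; exists v => //; apply: (on_seg_radii r0 (Qr _ _ ev) (Qr _ _ fw) _ hv hw).
    by move=> h; apply: (MM e f (Q e v)) => //; [exact: MQe | rewrite h; exact: MQe].
have eal e : ends e (al e) by rewrite /ends eqxx.
have ebe e : ends e (be e) by rewrite /ends eqxx orbT.
have Ujoin e : joined (U e) (p (al e)) (p (be e)).
  apply: (@joined_trans _ _ _ (Q e (al e))).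
    by apply: joined_seg => x h; right; exists (al e).
  apply: (@joined_trans _ _ _ (Q e (be e))); last first.
    by apply: joined_seg => x /on_segC h; right; exists (be e).
  apply: (@joined_sub _ (O e)); first by left.
  by case: (MQP e) => _ _ _ _ h; apply: h; [exact: oO | exact: MO].
have poly e : exists kf : nat * (nat -> R * R), [/\ (0 < kf.1)%N, kf.2 0%N = p (al e), kf.2
  kf.1 = p (be e) &
    [/\ forall i, (i < kf.1)%N -> forall x, on_seg (kf.2 i) (kf.2 i.+1) x -> U e x,
        forall i j, (i <= kf.1)%N -> (j <= kf.1)%N -> kf.2 i = kf.2 j -> i = j
      & forall i j, (i < kf.1)%N -> (j < kf.1)%N -> i <> j ->
          meet_at_ends (kf.2 i) (kf.2 i.+1) (kf.2 j) (kf.2 j.+1)]].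
  have nab : p (al e) <> p (be e).
    by move/(drawing_vertex_inj draw) => h; have := al_be e e; rewrite h eqxx.
  by have [k [f H]] := simple_polyline nab (Ujoin e); exists (k, f).
have [kf kfP] := choice poly.
pose k e := (kf e).1; pose pts e := (kf e).2.
have k0 e : (0 < k e)%N by case: (kfP e).
have pts0 e : pts e 0%N = p (al e) by case: (kfP e).
have ptsk e : pts e (k e) = p (be e) by case: (kfP e).
have ptsU e i : (i < k e)%N -> forall x, on_seg (pts e i) (pts e i.+1) x -> U e x.
  by case: (kfP e) => _ _ _ [h _ _]; exact: h.
have ptsi e i j : (i <= k e)%N -> (j <= k e)%N -> pts e i = pts e j -> i = j.
  by case: (kfP e) => _ _ _ [_ h _]; exact: h.
have ptsm e i j : (i < k e)%N -> (j < k e)%N -> i <> j ->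
    meet_at_ends (pts e i) (pts e i.+1) (pts e j) (pts e j.+1).
  by case: (kfP e) => _ _ _ [_ _ h]; exact: h.
have ptU e i : (i <= k e)%N -> U e (pts e i).
  move=> ik; have := k0 e; case: (ltngtP i (k e)) ik => // [ik _ _|-> _ kk].
    by apply: (ptsU e i ik); exact: on_seg_left.
  apply: (ptsU e (k e).-1); first by rewrite prednK.
  by rewrite prednK //; exact: on_seg_right.
have end_pts e v : ends e v -> exists2 i, (i = 0 \/ i = k e)%N & p v = pts e i.
  by move=> /orP[] /eqP->; [exists 0%N; auto | exists (k e); auto].
have end_seg e v i : ends e v -> (i < k e)%N -> on_seg (pts e i) (pts e i.+1) (p v) ->
    p v = pts e i \/ p v = pts e i.+1.
  move=> /orP[] /eqP-> ik; rewrite -?pts0 -?ptsk => h.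
    case: i ik h => [|i] ik h; first by left.
    by have [] := ptsm e 0%N i.+1 (k0 e) ik _ _ (on_seg_left _ _) h.
  have kk : (k e).-1.+1 = k e by rewrite prednK.
  have [ii|/eqP ii] := eqVneq i (k e).-1; first by right; rewrite ii kk.
  have := ptsm e (k e).-1 i _ ik (nesym ii) (pts e (k e)); rewrite kk => /(_ (leqnn _)).
  by move=> /(_ (on_seg_right _ _) h) [].
apply: (@polyline_bound R _ G al be p k pts) => //.
  move=> e ha hb; have [y [z [yz xy xz]]] := deg2 (al e).
  have mk w : adj (al e) w -> w = be e.
    move=> aw; have P : adj (al e, w).1 (al e, w).2 && ~~ col (al e, w).1 by rewrite /= aw col_al.
    by have /(congr1 be) : (exist _ (al e, w) P : bedge) = e by exact: ha.
  by apply: yz; rewrite (mk y xy) (mk z xz).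
split=> //.
- exact: drawing_vertex_inj draw.
- move=> e f i j ie jf h; have [ef|/eqP ef] := eqVneq e f.
    by subst f; left; split => //; exact: ptsi h.
  right; have [v [ev fv] zv] := UU e f _ ef (ptU e i ie) (eq_ind_r (U f) (ptU f j jf) h).
  have [i' hi' vi'] := end_pts e v ev; have [j' hj' vj'] := end_pts f v fv.
  have ii' : i = i' by apply: (ptsi e) => //; [case: hi' => ->; lia | rewrite zv].
  have jj' : j = j' by apply: (ptsi f) => //; [case: hj' => ->; lia | rewrite -h zv].
  by rewrite ii' jj'.
- move=> e f i j ie jf ne; have [ef|/eqP ef] := eqVneq e f.
    by subst f; apply: ptsm => // ij; apply: ne; rewrite ij.
  move=> x xe xf; have [v [ev fv] xv] := UU e f x ef (ptsU _ _ ie _ xe) (ptsU _ _ jf _ xf).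
  by rewrite xv in xe xf *; split; apply: end_seg.
Unshelve. all: end_near. Qed.

End DrawingBound.
Local Close Scope ring_scope.
Local Close Scope classical_set_scope.

(** * The inequality for planar bipartite graphs and for splits *)

Lemma planar_sub (R : realType) (H G : sgraph) (f : H -> G) : injective f ->
  (forall x y, adj x y -> adj (f x) (f y)) -> planar R G -> planar R H.
Proof.
move=> fi fa [p [arc D]]; exists (p \o f), (fun x y => arc (f x) (f y)); split => /=.
- by move=> x y /(drawing_vertex_inj D) /fi.
- by move=> x y /fa; exact: drawing_arc_sym D _ _.
- by move=> x y /fa; exact: drawing_arc D _ _.
- by move=> x y z /fa xy /(drawing_vertex_arc D xy) [/fi|/fi]; auto.
- move=> x y u v /fa xy /fa uv ne; set B := (X in (X `<=` _)%classic) => z /= hz.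
  have ne' : [set f x; f y]%classic <> [set f u; f v]%classic.
    move=> e; apply: ne; apply/seteqP; split => w hw.
      have : [set f x; f y]%classic (f w) by case: hw => ->; [left|right].
      by rewrite e => -[/fi ->|/fi ->]; [left|right].
    have : [set f u; f v]%classic (f w) by case: hw => ->; [left|right].
    by rewrite -e => -[/fi ->|/fi ->]; [left|right].
  have [w [w1 w2] <-] := drawing_no_crossing D xy uv ne' hz.
  have [w' ww'] : exists w', w = f w' by case: w1 => ->; [exists x|exists y].
  exists w'; last by rewrite /= ww'.
  rewrite ww' in w1 w2.
  by split; [case: w1 => /fi ->; [left|right] | case: w2 => /fi ->; [left|right]].
Qed.

Section Induced.
Variables (G : sgraph) (x : G).
Definition del_adj (y z : {y : G | y != x}) := adj (val y) (val z).
Lemma del_adj_sym : symmetric del_adj.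
Proof. by move=> y z; exact: adj_sym. Qed.
Lemma del_adj_irrefl : irreflexive del_adj.
Proof. by move=> y; exact: adj_irrefl. Qed.
Definition delete_vertex : sgraph := SGraph del_adj_sym del_adj_irrefl.
End Induced.

Definition edges (G : sgraph) (col : G -> bool) : {set G * G} :=
  [set e : G * G | adj e.1 e.2 && ~~ col e.1].

Lemma edges_le_sides (G : sgraph) (col : G -> bool) :
  (forall x y : G, adj x y -> col x != col y) ->
  exists a b, a + b = #|G| /\ #|edges col| <= a * b.
Proof.
move=> cp; exists #|[set x : G | ~~ col x]|, #|[set x : G | col x]|; split.
  rewrite -(cardsC [set x : G | col x]) addnC; congr (_ + _).
  by apply: eq_card => x; rewrite !inE.
rewrite -cardsX; apply: subset_leq_card; apply/fintype.subsetP => -[x y].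
by rewrite !inE /= => /andP[/cp xy cx]; move: xy; rewrite cx; case: (col x) cx; case: (col y).
Qed.

Lemma edges_delete (G : sgraph) (col : G -> bool) (x : G) :
  (forall x y : G, adj x y -> col x != col y) ->
  (forall y z, adj x y -> adj x z -> y = z) ->
  #|edges col| <= #|edges (fun y : delete_vertex x => col (val y))| + 1.
Proof.
move=> cp deg1.
set E' := edges (fun y : delete_vertex x => col (val y)).
pose g (e : delete_vertex x * delete_vertex x) := (val e.1, val e.2).
pose S := [set e in edges col | (e.1 == x) || (e.2 == x)].
have S1 : #|S| <= 1.
  apply/card_le1_eqP => -[a b] [c d]; rewrite !inE /=.
  move=> /andP[/andP[ab ca] h1] /andP[/andP[cd cc] h2].
  have cb := cp _ _ ab; have cdd := cp _ _ cd.
  case/orP: h1 => /eqP e1; case/orP: h2 => /eqP e2; subst.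
  - by rewrite (deg1 _ _ ab cd).
  - by rewrite (negbTE ca) (negbTE cc) in cdd.
  - by rewrite (negbTE ca) (negbTE cc) in cb.
  - by rewrite adj_sym in ab; rewrite adj_sym in cd; rewrite (deg1 _ _ ab cd).
have sub : edges col \subset (g @: E') :|: S.
  apply/fintype.subsetP => -[a b] ab; rewrite inE.
  have [h|] := boolP ((a == x) || (b == x)); first by rewrite orbC /S inE ab /= h.
  rewrite negb_or => /andP[ax bx]; apply/orP; left; apply/imsetP.
  by exists (exist _ a ax, exist _ b bx) => //; move: ab; rewrite !inE.
apply: leq_trans (subset_leq_card sub) _.
apply: leq_trans (leq_card_setU _ _) _.
by apply: leq_add => //; exact: leq_imset_card.
Qed.

(** Deleting a vertex of degree at most one lowers the left-hand side by at most
    one and the right-hand side by two; if there is none, the topological bound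
    applies. *)
Lemma planar_bipartite_bound (R : realType) (G : sgraph) (col : G -> bool) :
  (forall x y : G, adj x y -> col x != col y) -> planar R G ->
  2 < #|G| -> #|edges col| + 4 <= 2 * #|G|.
Proof.
move: {2}#|G| (erefl #|G|) => n.
elim: n => [|n IH] in G col *; first by move=> -> //.
move=> Gn cp pl G2.
have [low|] := pselect (exists x : G, forall y z, adj x y -> adj x z -> y = z).
  case: low => x deg1; have := edges_delete cp deg1.
  set G' := delete_vertex x; set E' := edges (fun y : G' => col (val y)).
  have cG' : #|G'| = n.
    by rewrite card_sig -[RHS]/(n.+1.-1) -Gn -(cardC1 x); apply: eq_card => y; rewrite !inE.
  have cp' : forall y z : G', adj y z -> col (val y) != col (val z).
    by move=> y z; exact: cp.
  have pl' : planar R G' by apply: planar_sub pl; [exact: val_inj | done].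
  have [n2|n2] := leqP n 2.
    have [a [b [ab le]]] := edges_le_sides cp'; rewrite -/E' cG' in ab le *.
    have ab1 : a * b <= 1 by case: a ab le => [|[|[|a]]]; case: b => [|[|[|b]]] //=; lia.
    by move=> h; move: (leq_trans le ab1); lia.
  have := IH G' (fun y => col (val y)) cG' cp' pl'; rewrite cG' -/E' => /(_ n2); lia.
move=> /forallNP hi.
have deg2 : forall x : G, exists y z, [/\ y <> z, adj x y & adj x z].
  move=> x; apply: contrapT => h; apply: (hi x) => y z xy xz.
  by apply: contrapT => yz; apply: h; exists y, z.
case: pl => p [arc D].
have cE : #|{: bedge col}| = #|edges col|.
  by rewrite card_sig; apply: eq_card => e; rewrite !inE.
rewrite -cE; apply: (drawing_bound D cp deg2); rewrite cE.
have [x _] := card_gt0P (ltn_trans (isT : 0 < 2) G2).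
have [y [z [_ xy _]]] := deg2 x.
apply/card_gt0P; case cx : (col x).
  exists (y, x); rewrite inE /= adj_sym xy /=.
  by have := cp _ _ xy; rewrite cx; case: (col y).
by exists (x, y); rewrite inE /= xy cx.
Qed.

(** A split projects onto the original graph by forgetting the indices of the
    copies.  The last clause, that an unsplit vertex is alone in its fibre, is
    what keeps the fibres of size at most [k] when this vertex is split. *)
Lemma ksplit_hom k (G H : sgraph) (S : pred H) : 0 < k -> ksplit k G H S ->
  exists f : H -> G,
    [/\ forall x y, adj x y -> adj (f x) (f y),
        forall x y, adj x y -> exists u v, [/\ f u = x, f v = y & adj u v],
        forall x, #|[set u | f u == x]| <= k
      & forall u w, S u -> f w = f u -> w = u].
Proof.
move=> k0; elim => {H S} [|H S v j c _ [f [fa fe fk fS]] Sv jk cov].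
  exists id; split => //; first by move=> x y xy; exists x, y.
  by move=> x; rewrite (_ : [set u | u == x] = [set x]) ?cards1 //; apply/setP => u; rewrite !inE.
pose f' (x : split_graph v c) := match x with inl a => f (val a) | inr _ => f v end.
exists f'; split.
- case=> [a|i] [b|l] //=; first exact: fa.
    by move=> /andP[va _]; rewrite adj_sym; exact: fa.
  by move=> /andP[va _]; exact: fa.
- move=> x y /fe [u [w [fu fw uw]]].
  have [uv|uv] := eqVneq u v.
    subst u; have wv : w != v by apply: contraTneq uw => ->; rewrite adj_irrefl.
    have [i wi] := cov w uw.
    by exists (inr i), (inl (exist _ w wv)); split => //=; rewrite uw wi.
  have [wv|wv] := eqVneq w v.
    subst w; rewrite adj_sym in uw; have [i ui] := cov u uw.
    by exists (inl (exist _ u uv)), (inr i); split => //=; rewrite uw ui.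
  by exists (inl (exist _ u uv)), (inl (exist _ w wv)).
- move=> x; have [xv|xv] := eqVneq x (f v).
    apply: leq_trans jk; rewrite -[X in _ <= X]card_ord -(card_imset _ (@inr_inj {x : H | x !=
      v} 'I_j)).
    apply: subset_leq_card; apply/fintype.subsetP => -[a|i]; last by move=> _; exact: imset_f.
    rewrite inE /= xv => /eqP h.
    by have := fS _ _ Sv h => av; have := valP a; rewrite /= av eqxx.
  apply: leq_trans (fk x).
  have -> : [set u | f' u == x] =
      [set inl a | a in [set a : {y : H | y != v} | f (val a) == x]].
    apply/setP => -[a|i]; rewrite inE /=.
      by rewrite mem_imset ?inE //; exact: inl_inj.
    by rewrite eq_sym (negbTE xv); apply/esym/negP => /imsetP[].
  rewrite card_imset; last exact: inl_inj.
  rewrite -(card_imset _ val_inj); apply: subset_leq_card.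
  by apply/fintype.subsetP => _ /imsetP[a + ->]; rewrite !inE.
- case=> [a|i] [b|l] //= Sa.
    by move=> /(fS _ _ Sa) /val_inj ->.
  by move=> /(fS _ _ Sa) h; have := valP a; rewrite /= -h eqxx.
Qed.

(** Count vertices by fibres and edges by lifting those of [K_{m,n}].  A split with
    at most two vertices has at most one edge. *)
Lemma splittable_Kmn_bound (R : realType) (m n : nat) : 0 < m -> 0 < n ->
  splittable R 2 (Kmn m n) -> n * m <= 4 * (n + m) - 4.
Proof.
move=> m0 n0 [H [S [ks pl]]].
have [f [fa fe fk _]] := ksplit_hom (isT : 0 < 2) ks.
pose col (u : H) := if f u is inr _ then true else false.
have cp x y : adj x y -> col x != col y.
  by move=> /fa; rewrite /col; case: (f x) => ?; case: (f y).
have cH : #|H| <= 2 * (n + m).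
  rewrite -sum1_card (partition_big f xpredT) //=.
  apply: (@leq_trans (\sum_(x : Kmn m n) 2)).
    by apply: leq_sum => x _; apply: leq_trans (fk x); rewrite sum1_card cardsE.
  by rewrite sum_nat_const card_sum !card_ord; lia.
have cE : m * n <= #|edges col|.
  have pr (ij : 'I_m * 'I_n) : exists e : H * H,
      [/\ f e.1 = inl ij.1, f e.2 = inr ij.2 & adj e.1 e.2].
    by have [u [w h]] := fe (inl ij.1) (inr ij.2) isT; exists (u, w).
  have [g gP] := choice pr.
  have gi : injective g.
    move=> [a b] [c d] gg; have [h1 h2 _] := gP (a, b); have [h3 h4 _] := gP (c, d).
    by move: h1 h2; rewrite gg h3 h4 => -[->] [->].
  rewrite -{1}(card_ord m) -{1}(card_ord n) -card_prod -(card_imset _ gi).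
  apply: subset_leq_card; apply/fintype.subsetP => _ /imsetP[ij _ ->].
  by have [h1 h2 h3] := gP ij; rewrite inE h3 /col h1.
have [H2|H2] := leqP #|H| 2.
  have [a [b [ab le]]] := edges_le_sides cp; rewrite -ab in H2.
  have ab1 : a * b <= 1 by case: a ab H2 le => [|[|[|a]]]; case: b => [|[|[|b]]] //=; lia.
  have mn1 : m * n <= 1 by apply: leq_trans cE (leq_trans le ab1).
  by lia.
by have := planar_bipartite_bound cp pl H2; lia.
Qed.

(** A plan for splitting every vertex of [G]: the graph [T] of all copies, with [f]
    sending a copy to its original.  The plan is carried out one vertex after the
    other, and an intermediate graph is labelled by [T + G], with [inl] for the
    copies already made and [inr] for the vertices still to be split. *)
Section SplitPlan.
Variables (k : nat) (G T : sgraph) (f : T -> G).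
Hypothesis f_fibre : forall x, #|[set u | f u == x]| <= k.
Hypothesis f_edge : forall x y, adj x y -> exists u v, [/\ f u = x, f v = y & adj u v].

Definition mixed_adj (x y : T + G) : bool :=
  match x, y with
  | inl t, inl t' => adj t t'
  | inl t, inr g | inr g, inl t => [exists t', (f t' == g) && adj t t']
  | inr g, inr g' => adj g g'
  end.

Lemma mixed_adj_sym : symmetric mixed_adj.
Proof. by move=> [t|g] [t'|g'] //=; exact: adj_sym. Qed.

Definition unsplit_label (x : T + G) : bool := if x is inr _ then true else false.

(** The last clause says that a vertex which has a copy is not waiting to be
    split; it keeps the labelling injective in the next step. *)
Definition partial_plan (H : sgraph) (S : pred H) (l : H -> T + G) : Prop :=
  [/\ injective l, forall x y, adj x y -> mixed_adj (l x) (l y),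
      forall x, S x = unsplit_label (l x)
    & forall x y t, l x = inl t -> l y = inr (f t) -> False].

Lemma partial_plan_step (H : sgraph) (S : pred H) (l : H -> T + G) (v : H) :
  partial_plan S l -> S v ->
  exists j (c : 'I_j -> {set H}) l', [/\ j <= k, covers_neighbours v c &
    partial_plan (split_unsplit v c S) l'].
Proof.
move=> [li la lS lf] Sv.
have [g lv] : exists g, l v = inr g.
  by have := lS v; rewrite Sv; case: (l v) => // g _; exists g.
pose A := [set u | f u == g].
pose c (i : 'I_#|A|) := [set w : H | mixed_adj (inl (enum_val i)) (l w)].
pose l' (x : split_graph v c) : T + G :=
  match x with inl a => l (val a) | inr i => inl (enum_val i) end.
have fA (i : 'I_#|A|) : f (enum_val i) = g.
  by have := enum_valP i; rewrite inE => /eqP.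
have A_ord t : f t = g -> exists i : 'I_#|A|, enum_val i = t.
  move=> ft; have tA : t \in A by rewrite inE ft.
  by exists (enum_rank_in tA t); rewrite enum_rankK_in.
exists #|A|, c, l'; split; first exact: f_fibre.
- move=> w vw; have := la _ _ vw; rewrite lv; case E : (l w) => [t|g'] /=.
    move=> /existsP[t' /andP[/eqP ft' tt']]; have [i it] := A_ord t' ft'.
    by exists i; rewrite inE E /= it adj_sym.
  move=> /f_edge [u [u' [fu fu' uu']]]; have [i it] := A_ord u fu.
  by exists i; rewrite inE E /= it; apply/existsP; exists u'; rewrite fu' eqxx.
- split.
  + case=> [a|i] [b|i'] //=.
    * by move=> /li /val_inj ->.
    * by move=> h; case: (lf _ _ _ h (etrans lv (congr1 inr (esym (fA i'))))).
    * by move=> /esym h; case: (lf _ _ _ h (etrans lv (congr1 inr (esym (fA i))))).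
    * by move=> [/enum_val_inj ->].
  + case=> [a|i] [b|i'] //=; first exact: la.
      by rewrite inE mixed_adj_sym => /andP[_].
    by rewrite inE => /andP[_].
  + by case=> [a|i] /=.
  + case=> [a|i] [b|i'] t //=; first exact: lf.
    move=> [<-]; rewrite fA -lv => /li h.
    by have := valP b; rewrite /= h eqxx.
Qed.

(** When nothing is left to split, the labelling embeds the graph obtained into
    [T], and planarity passes to subgraphs. *)
Lemma split_plan (R : realType) : planar R T -> splittable R k G.
Proof.
move=> plT.
suff main N (H : sgraph) (S : pred H) l : ksplit k G H S -> partial_plan S l ->
    #|[set x | S x]| <= N -> splittable R k G.
  apply: (main _ G predT inr (ksplit_refl _ _) _ (leqnn _)).
  by split => // x y [].
elim: N => [|N IH] in H S l *.
  move=> ks [li la lS _]; rewrite leqn0 cards_eq0 => /eqP S0.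
  have ex x : exists t, l x = inl t.
    have := lS x; case: (l x) => [t|g] /=; first by exists t.
    move=> Sx; have xS : x \in [set y | S y] by rewrite inE.
    by rewrite S0 inE in xS.
  have [h hl] := choice ex.
  exists H, S; split => //; apply: planar_sub plT.
    by move=> x y hxy; apply: li; rewrite !hl; congr inl; exact: hxy.
  by move=> x y /la; rewrite !hl.
move=> ks pp SN; have [v Sv|S0] := pickP S; last first.
  apply: (IH H S l ks pp); rewrite (_ : [set x | S x] = finset.set0) ?cards0 //.
  by apply/setP => x; rewrite !inE S0.
have [j [c [l' [jk cov pp']]]] := partial_plan_step pp Sv.
apply: (IH _ _ _ (ksplit_step ks Sv jk cov) pp').
rewrite -ltnS; apply: leq_trans SN.
rewrite (cardsD1 v) inE Sv add1n ltnS.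
have -> : [set x | split_unsplit v c S x] = [set inl a | a in [set a : {y : H | y != v} | S
  (val a)]].
  apply/setP => -[a|i]; rewrite inE /=.
    by rewrite mem_imset ?inE //; exact: inl_inj.
  by apply/esym/negP => /imsetP[].
rewrite card_imset; last exact: inl_inj.
rewrite -(card_imset _ val_inj); apply: subset_leq_card.
by apply/fintype.subsetP => _ /imsetP[a + ->]; rewrite !inE => ->; rewrite (valP a).
Qed.

End SplitPlan.

(** * Straight-line drawings *)

Local Open Scope ring_scope.
(** Twice the signed area of the triangle [abc]. *)
Definition orient (K : pzRingType) (a b c : K * K) : K :=
  (b.1 - a.1) * (c.2 - a.2) - (b.2 - a.2) * (c.1 - a.1).

Section StraightLine.
Variable R : realType.
Implicit Types a b c d x : (R * R)%type.

Lemma orient_on_seg a b x : on_seg a b x -> orient a b x = 0.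
Proof. by case=> t _ ->; rewrite /orient /=; ring. Qed.

(** The line [ab] separates the two segments if [c] and [d] are strictly on the
    same side of it. *)
Lemma orient_same_side a b c d x : on_seg a b x -> on_seg c d x ->
  0 < orient a b c * orient a b d -> False.
Proof.
move=> /orient_on_seg abx [t /andP[t0 t1] xE].
have : (1 - t) * orient a b c + t * orient a b d = 0.
  by rewrite -[RHS]abx xE /orient /=; ring.
set u := orient a b c; set v := orient a b d => e uv.
have u0 : u != 0 by apply: contraTneq uv => ->; rewrite mul0r ltxx.
have : u * ((1 - t) * u + t * v) = 0 by rewrite e mulr0.
have -> : u * ((1 - t) * u + t * v) = (1 - t) * u ^+ 2 + t * (u * v) by ring.
have su : 0 < u ^+ 2 by rewrite exprn_even_gt0.
have [->|tn] := eqVneq t 0; first by lra.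
have tp : 0 < t * (u * v) by rewrite mulr_gt0 // lt_def tn.
have : 0 <= (1 - t) * u ^+ 2 by rewrite mulr_ge0 ?subr_ge0 // ltW.
by lra.
Qed.

Lemma orient_share a b d x : on_seg a b x -> on_seg a d x -> orient a b d != 0 -> x = a.
Proof.
move=> /orient_on_seg abx [t _ xE] od.
have : t * orient a b d = 0 by rewrite -[RHS]abx xE /orient /=; ring.
move/eqP; rewrite mulf_eq0 (negbTE od) orbF => /eqP t0.
by rewrite xE t0 !mul0r !addr0 -surjective_pairing.
Qed.

Lemma segment_arc a b : a <> b -> is_arc a b [set x | on_seg a b x]%classic.
Proof.
move=> ab; exists (fun t => a + t *: (b - a)); split.
- by apply: continuous_subspaceT; exact: affine_continuous.
- move=> s t _ _ /addrI /eqP; rewrite -subr_eq0 -scalerBl scaler_eq0 !subr_eq0.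
  by case/orP => /eqP // e; case: ab.
- by rewrite scale0r addr0.
- by rewrite scale1r addrC subrK.
- apply/seteqP; split=> x [t t01 e]; exists t.
  + by move: t01; rewrite /= in_itv.
  + by rewrite -e.
  + by rewrite /= in_itv.
  + by rewrite e.
Qed.

(** For disjoint segments in general position, the line through one of them leaves
    the other on one side; so these sign conditions express planarity. *)
Lemma straight_planar (G : sgraph) (p : G -> R * R) : injective p ->
  (forall x y z : G, adj x y -> z != x -> z != y -> orient (p x) (p y) (p z) != 0) ->
  (forall x y u v : G, adj x y -> adj u v -> x != u -> x != v -> y != u -> y != v ->
     0 < orient (p x) (p y) (p u) * orient (p x) (p y) (p v) \/
     0 < orient (p u) (p v) (p x) * orient (p u) (p v) (p y)) ->
  planar R G.
Proof.
move=> pi H1 H2; exists p, (fun x y : G => [set z | on_seg (p x) (p y) z]%classic).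
have nadj (x y : G) : adj x y -> x != y by move=> xy; apply: contraTneq xy => ->;
  rewrite adj_irrefl.
split => //.
- by move=> x y _; apply/seteqP; split => z /on_segC.
- by move=> x y xy; apply: segment_arc => /pi /eqP; rewrite (negbTE (nadj _ _ xy)).
- move=> x y z xy /= hz; have [zx|zx] := eqVneq z x; first by left.
  have [zy|zy] := eqVneq z y; first by right.
  by have := H1 x y z xy zx zy; rewrite (orient_on_seg hz) eqxx.
move=> x y u v xy uv ne z [/= h1 h2].
have share (a b d : G) : adj a b -> adj a d -> d != b ->
    on_seg (p a) (p b) z -> on_seg (p a) (p d) z -> z = p a.
  move=> ab ad db ha hb; apply: orient_share ha hb _; apply: H1 => //.
  by rewrite eq_sym nadj.
have yx : adj y x by rewrite adj_sym.
have vu : adj v u by rewrite adj_sym.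
have [xu|xu] := eqVneq x u.
  subst u; exists x; last by apply/esym; apply: (share x y v) => //;
    apply: contra_notN ne => /eqP ->.
  by split; left.
have [xv|xv] := eqVneq x v.
  subst v; exists x; last first.
    apply/esym; apply: (share x y u) => //; last exact: on_segC.
    by apply: contra_notN ne => /eqP ->; apply/seteqP; split => w /= [->|->]; auto.
  by split; [left|right].
have [yu|yu] := eqVneq y u.
  subst u; exists y; last first.
    apply/esym; apply: (share y x v) => //; last exact: on_segC.
    by apply: contra_notN ne => /eqP ->; apply/seteqP; split => w /= [->|->]; auto.
  by split; [right|left].
have [yv|yv] := eqVneq y v.
  subst v; exists y; last first.
    apply/esym; apply: (share y x u) => //; try exact: on_segC.
    by apply: contra_notN ne => /eqP ->.
  by split; [right|right].
by case: (H2 x y u v xy uv xu xv yu yv) => h;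
  [case: (orient_same_side h1 h2 h) | case: (orient_same_side h2 h1 h)].
Qed.

End StraightLine.

Section Tables.
Variables (pts : seq (nat * nat)) (E : seq (nat * nat)).

(** The conditions of [straight_planar] are computed with binary integers and
    then carried over to the reals. *)
Definition orientZ (a b c : Z * Z) : Z :=
  Z.sub (Z.mul (Z.sub b.1 a.1) (Z.sub c.2 a.2)) (Z.mul (Z.sub b.2 a.2) (Z.sub c.1 a.1)).

Let P (i : nat) : Z * Z :=
  let a := nth (0, 0)%N pts i in (Z.of_nat a.1, Z.of_nat a.2).

Definition no_three_collinear : bool :=
  all (fun e => all (fun k => [|| k == e.1, k == e.2 |
    ~~ Z.eqb (orientZ (P e.1) (P e.2) (P k)) Z0]) (iota 0 (size pts))) E.

Definition no_crossing : bool :=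
  all (fun e => all (fun f =>
    [|| e.1 == f.1, e.1 == f.2, e.2 == f.1, e.2 == f.2,
        Z.ltb Z0 (Z.mul (orientZ (P e.1) (P e.2) (P f.1)) (orientZ (P e.1) (P e.2) (P f.2))) |
        Z.ltb Z0 (Z.mul (orientZ (P f.1) (P f.2) (P e.1)) (orientZ (P f.1) (P f.2) (P e.2)))])
          E) E.

Definition table_drawing := [&& uniq pts, no_three_collinear & no_crossing].

Variable R : realType.
Definition realZ (z : Z) : R := (int_of_Z z)%:~R.
Definition realZ2 (a : Z * Z) : R * R := (realZ a.1, realZ a.2).

Lemma realZ_orient a b c : realZ (orientZ a b c) = orient (realZ2 a) (realZ2 b) (realZ2 c).
Proof.
rewrite /realZ /orientZ /orient /=.
by rewrite -[X in int_of_Z X]/((b.1 - a.1) * (c.2 - a.2) - (b.2 - a.2) * (c.1 - a.1))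
   !(rmorphB, rmorphM).
Qed.

Lemma realZ_gt0 z : Z.ltb Z0 z -> 0 < realZ z.
Proof. by rewrite /realZ ltr0z; case: z => //= p _; rewrite ltz_nat; lia. Qed.

Lemma realZ_inj : injective realZ.
Proof. by move=> x y /(@intr_inj R) h; rewrite -[x]int_of_ZK h int_of_ZK. Qed.

Lemma realZ0 : realZ Z0 = 0.
Proof. by []. Qed.

Lemma realZM x y : realZ (Z.mul x y) = realZ x * realZ y.
Proof. by rewrite /realZ -[X in int_of_Z X]/(x * y)%R !rmorphM. Qed.

Lemma table_planar (G : sgraph) (ix : G -> nat) : table_drawing -> injective ix ->
  (forall x, (ix x < size pts)%N) ->
  (forall x y, adj x y -> (ix x, ix y) \in E \/ (ix y, ix x) \in E) -> planar R G.
Proof.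
move=> /and3P[up /allP c1 /allP c2] ii si aE.
have symo a b c : orient (realZ2 a) (realZ2 b) (realZ2 c) = - orient (realZ2 b) (realZ2 a)
  (realZ2 c).
  by rewrite /orient; ring.
apply: (@straight_planar R G (realZ2 \o P \o ix)).
- move=> x y /= [/realZ_inj /Nat2Z.inj h1 /realZ_inj /Nat2Z.inj h2]; apply: ii; apply/eqP.
  by rewrite -(nth_uniq (0, 0)%N (si x) (si y) up) [nth _ _ _]surjective_pairing h1 h2
    -surjective_pairing.
- move=> x y z xy zx zy /=.
  have K a b : (a, b) \in E -> ix z != a -> ix z != b ->
      orient (realZ2 (P a)) (realZ2 (P b)) (realZ2 (P (ix z))) != 0.
    move=> /c1 /allP /(_ (ix z)); rewrite mem_iota add0n si => /(_ isT) /= h za zb.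
    move: h; rewrite (negbTE za) (negbTE zb) /= => h.
    rewrite -realZ_orient; apply: contraNN h => /eqP; rewrite -realZ0 => /realZ_inj ->.
    by [].
  case: (aE _ _ xy) => h; first by apply: K; rewrite ?inj_eq.
  by rewrite symo oppr_eq0; apply: K; rewrite ?inj_eq.
move=> x y u v xy uv xu xv yu yv /=.
pose c a b := orient (realZ2 (P a)) (realZ2 (P b)).
have K a b a' b' : (a, b) \in E -> (a', b') \in E -> a != a' -> a != b' -> b != a' -> b != b' ->
  0 < c a b (realZ2 (P a')) * c a b (realZ2 (P b')) \/
  0 < c a' b' (realZ2 (P a)) * c a' b' (realZ2 (P b)).
  move=> h1 h2 n1 n2 n3 n4; have /allP /(_ _ h2) /= := c2 _ h1.
  rewrite (negbTE n1) (negbTE n2) (negbTE n3) (negbTE n4) /=.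
  by rewrite /c -!realZ_orient -!realZM => /orP[] /realZ_gt0; auto.
have pos (s t : R) : s = t -> 0 < s -> 0 < t by move=> ->.
rewrite -/(c (ix x) (ix y)) -/(c (ix u) (ix v)).
by case: (aE _ _ xy) => h1; case: (aE _ _ uv) => h2;
  case: (K _ _ _ _ h1 h2); rewrite ?(inj_eq ii) // => h;
    [left|right|left|right|left|right|left|right];
  apply: pos h; rewrite /c /orient; ring.
Qed.

End Tables.
Local Close Scope ring_scope.

(** * Planar splits of complete bipartite graphs *)

Section BipartiteGraph.
Variables (B W : finType) (e : B -> W -> bool).

Definition bip_adj (x y : B + W) : bool :=
  match x, y with
  | inl b, inr w | inr w, inl b => e b w
  | _, _ => false
  end.

Lemma bip_adj_sym : symmetric bip_adj.
Proof. by case=> [b|w] []. Qed.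

Lemma bip_adj_irrefl : irreflexive bip_adj.
Proof. by case. Qed.

Definition bip_graph : sgraph := SGraph bip_adj_sym bip_adj_irrefl.

(** Both orders of the two sides are obtained at once, since the bound is symmetric
    but the drawings are given for one order only. *)
Lemma bip_plan (R : realType) (k m n : nat) (lb : B -> 'I_m) (lw : W -> 'I_n) :
  (forall i, #|[set b | lb b == i]| <= k) -> (forall j, #|[set w | lw w == j]| <= k) ->
  (forall i j, exists b w, [/\ lb b = i, lw w = j & e b w]) ->
  planar R bip_graph -> splittable R k (Kmn m n) /\ splittable R k (Kmn n m).
Proof.
move=> fb fw cov pl; split.
  pose f (x : bip_graph) : Kmn m n :=
    match x with inl b => inl (lb b) | inr w => inr (lw w) end.
  apply: (@split_plan k _ _ f) pl.
    case=> [i|j]; [apply: leq_trans (fb i) | apply: leq_trans (fw j)].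
      rewrite -(card_imset _ (@inl_inj B W)); apply: subset_leq_card.
      by apply/fintype.subsetP => -[b|w]; rewrite !inE // => h; apply: imset_f; rewrite inE.
    rewrite -(card_imset _ (@inr_inj B W)); apply: subset_leq_card.
    by apply/fintype.subsetP => -[b|w]; rewrite !inE // => h; apply: imset_f; rewrite inE.
  case=> [i|j] [i'|j'] // _; [have [b [w [<- <- ew]]] := cov i j' | have [b [w [<- <- ew]]] :=
    cov i' j].
    by exists (inl b), (inr w).
  by exists (inr w), (inl b).
pose f (x : bip_graph) : Kmn n m :=
  match x with inl b => inr (lb b) | inr w => inl (lw w) end.
apply: (@split_plan k _ _ f) pl.
  case=> [j|i]; [apply: leq_trans (fw j) | apply: leq_trans (fb i)].
    rewrite -(card_imset _ (@inr_inj B W)); apply: subset_leq_card.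
    by apply/fintype.subsetP => -[b|w]; rewrite !inE // => h; apply: imset_f; rewrite inE.
  rewrite -(card_imset _ (@inl_inj B W)); apply: subset_leq_card.
  by apply/fintype.subsetP => -[b|w]; rewrite !inE // => h; apply: imset_f; rewrite inE.
case=> [j|i] [j'|i'] // _; [have [b [w [<- <- ew]]] := cov i' j | have [b [w [<- <- ew]]] :=
  cov i j'].
  by exists (inr w), (inl b).
by exists (inl b), (inr w).
Qed.

End BipartiteGraph.

Lemma card_fibre_snd (T : finType) (x : T) :
  #|[set u : bool * T | u.2 == x]| <= 2.
Proof.
have inj : injective (fun b : bool => (b, x)) by move=> b c [].
apply: (@leq_trans #|[set (b, x) | b : bool]|); last by rewrite card_imset // card_bool.
apply: subset_leq_card; apply/fintype.subsetP => -[b y]; rewrite inE /= => /eqP ->.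
exact: imset_f.
Qed.

(** The black vertices are not split and those numbered 0, 1 are joined to the
    first copies of the white ones, 2 and 3 to the second copies.  This gives
    subgraphs of two copies of [K_{2,n}], one drawn above and one below the horizontal axis, with
    the white vertices on the vertical axis. *)
Section FourByN.
Variables (R : realType) (m n : nat).
Hypothesis m4 : m <= 4.
Local Open Scope ring_scope.

Let e (a : 'I_m) (w : bool * 'I_n) : bool := w.1 == (2 <= a)%N.
Let X (a : 'I_m) : R := (if odd a then 1 else -1) * (if (a < 2)%N then 2 else 1).
Let Y (w : bool * 'I_n) : R := (if w.1 then -1 else 1) * (w.2).+1%:R.

Let p (x : bip_graph e) : R * R :=
  match x with inl a => (X a, 0) | inr w => (0, Y w) end.

Let X_inj : injective X.
Proof.
move=> [a ha] [b hb] h; apply/val_inj => /=; move: h; rewrite /X /=.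
have {ha}ha := leq_trans ha m4; have {hb}hb := leq_trans hb m4.
by move: a b ha hb => [|[|[|[|a]]]] // [|[|[|[|b]]]] //= _ _ h; exfalso; lra.
Qed.

Let Y_inj : injective Y.
Proof.
move=> [s i] [t j]; rewrite /Y /= => h.
have i0 : 0 < i.+1%:R :> R by rewrite ltr0n.
have j0 : 0 < j.+1%:R :> R by rewrite ltr0n.
have st : s = t by case: s t h => -[] // h; exfalso; lra.
have ij : i.+1%:R = j.+1%:R :> R by move: h; rewrite st; case: (t); lra.
congr pair => //; apply/val_inj/eqP; rewrite -eqSS.
by have := eqr_nat R i.+1 j.+1; rewrite ij eqxx => <-.
Qed.

Let X0 a : X a != 0.
Proof. by rewrite /X; case: ifP => _; case: ifP => _;
  rewrite ?mulN1r ?mul1r ?oppr_eq0 ?pnatr_eq0 ?oner_eq0. Qed.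

Let Y0 w : Y w != 0.
Proof. by rewrite /Y mulf_neq0 ?pnatr_eq0 //; case: ifP; rewrite ?oppr_eq0 oner_eq0. Qed.

Lemma four_by_n_planar : planar R (bip_graph e).
Proof.
apply: (@straight_planar R (bip_graph e) p).
- move=> [a|w] [b|w'] //= [] => [/X_inj -> //|h|h|/Y_inj -> //].
    by have := X0 a; rewrite h eqxx.
  by have := X0 b; rewrite -h eqxx.
- have K a w z : z != inl a :> bip_graph e -> z != inr w -> orient (X a, 0) (0, Y w) (p z) != 0.
    case: z => [b|w'] h1 h2.
      have -> : orient (X a, 0) (0, Y w) (p (inl b)) = Y w * (X a - X b) by rewrite /orient /=;
        ring.
      rewrite mulf_neq0 ?Y0 // subr_eq0; apply: contraNN h1 => /eqP /X_inj ->.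
      by rewrite eqxx.
    have -> : orient (X a, 0) (0, Y w) (p (inr w')) = X a * (Y w - Y w') by rewrite /orient /=;
      ring.
    rewrite mulf_neq0 ?X0 // subr_eq0; apply: contraNN h2 => /eqP /Y_inj ->.
    by rewrite eqxx.
  move=> [a|w] [b|w'] z //= ew h1 h2; first exact: K.
  have -> : orient (0, Y w) (X b, 0) (p z) = - orient (X b, 0) (0, Y w) (p z) by rewrite
    /orient /=; ring.
  by rewrite oppr_eq0 K.
(* For edges on the same side of the horizontal axis, one of the products
   [X a * Y w] and [X b * Y w'] is positive and the other one is negative. *)
have K a w b w' : e a w -> e b w' -> a != b -> w != w' ->
    0 < (X a * Y w) * ((X a - X b) * (Y w - Y w')) \/
    0 < (X b * Y w') * ((X a - X b) * (Y w - Y w')).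
  case: w w' => [s i] [t j] /eqP /= sa /eqP /= tb ab ww'.
  have Yn : Y (s, i) != Y (t, j) by rewrite (inj_eq Y_inj).
  have Xn : X a != X b by rewrite (inj_eq X_inj).
  have Xv (c : 'I_m) : let v := if (2 <= c)%N then 1 else 2 in X c = v \/ X c = - v.
    by rewrite /X ltnNge; case: (2 <= c)%N; case: (odd c); [left|right|left|right]; rewrite /=;
      ring.
  move: (Xv a) (Xv b) Xn Yn; rewrite /= -sa -tb /Y /=.
  set I := i.+1%:R; set J := j.+1%:R.
  have I0 : 0 < I by rewrite ltr0n.
  have J0 : 0 < J by rewrite ltr0n.
  have IIJ : 0 < I * (I + J) by rewrite mulr_gt0 // addr_gt0.
  have JIJ : 0 < J * (I + J) by rewrite mulr_gt0 // addr_gt0.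
  have IJ : I < J -> 0 < J * (J - I) by move=> h; rewrite mulr_gt0 // subr_gt0.
  have JI : J < I -> 0 < I * (I - J) by move=> h; rewrite mulr_gt0 // subr_gt0.
  clear -IIJ JIJ IJ JI.
  case: s; case: t => /= -[->|->] [->|->]; rewrite ?eqxx //= ?mulN1r ?mul1r ?eqr_opp => _ ij;
    try (by left; lra); try (by right; lra);
    (case: (ltgtP I J) ij => // h _; [have {}h := IJ h | have {}h := JI h]);
    first [by left; lra | by right; lra].
have pos (s t : R) : s = t -> 0 < s -> 0 < t by move=> ->.
move=> [a|w] [b|w'] [c|w1] [d|w2] //= h1 h2 n1 n2 n3 n4.
- by case: (K a w' c w2) => // h; [left|right]; apply: pos h; rewrite /orient /=; ring.
- by case: (K a w' d w1) => // h; [left|right]; apply: pos h; rewrite /orient /=; ring.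
- by case: (K b w c w2) => // h; [left|right]; apply: pos h; rewrite /orient /=; ring.
- by case: (K b w d w1) => // h; [left|right]; apply: pos h; rewrite /orient /=; ring.
Qed.

Lemma four_by_n_splittable : splittable R 2 (Kmn m n) /\ splittable R 2 (Kmn n m).
Proof.
apply: (bip_plan (lb := id) (lw := snd)) four_by_n_planar.
- by move=> i; rewrite (_ : [set b | b == i] = [set i]%SET) ?cards1 //; apply/setP => b;
  rewrite !inE.
- exact: card_fibre_snd.
- by move=> i j; exists i, ((2 <= i)%N, j); split; rewrite /e ?eqxx.
Qed.

End FourByN.

(** A table lists the positions of the black vertices, and the positions and the
    neighbours of the white ones; the copies of the vertex [i] of either side have
    the numbers [2 * i] and [2 * i + 1].  All vertices are numbered together, the
    black ones first. *)
Section TableGraph.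
Variables (blacks : seq (nat * nat)) (whites : seq ((nat * nat) * seq nat)).

Definition table_points : seq (nat * nat) := blacks ++ map fst whites.

Definition table_edges : seq (nat * nat) :=
  [seq (b, size blacks + w) | w <- iota 0 (size whites),
     b <- (nth ((0, 0), [::]) whites w).2].

Definition table_edge (b i c j : nat) : bool :=
  (i.*2 + b, size blacks + (j.*2 + c)) \in table_edges.

Definition table_splits (m n : nat) : bool :=
  [&& size blacks == m.*2, size whites == n.*2,
      table_drawing table_points table_edges
    & all (fun i => all (fun j =>
        has (fun b => has (fun c => table_edge b i c j) (iota 0 2)) (iota 0 2))
      (iota 0 n)) (iota 0 m)].

Lemma table_splittable (R : realType) (m n m' n' : nat) : m <= m' -> n <= n' ->
  table_splits m' n' -> splittable R 2 (Kmn m n) /\ splittable R 2 (Kmn n m).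
Proof.
move=> mm nn /and4P[/eqP sb /eqP sw td /allP cov].
pose e (b : bool * 'I_m) (w : bool * 'I_n) := table_edge b.1 b.2 w.1 w.2.
apply: (@bip_plan _ _ e R 2 m n snd snd) => [i|j|i j|].
- exact: card_fibre_snd.
- exact: card_fibre_snd.
- have im : (i : nat) \in iota 0 m' by rewrite mem_iota /= add0n (leq_trans _ mm).
  have jn : (j : nat) \in iota 0 n' by rewrite mem_iota /= add0n (leq_trans _ nn).
  have /allP /(_ _ jn) /hasP[b b2 /hasP[c c2 ebc]] := cov _ im.
  have bit d : d \in iota 0 2 -> exists s : bool, s = d :> nat.
    by rewrite !inE => /orP[] /eqP->; [exists false | exists true].
  have [s sE] := bit b b2; have [t tE] := bit c c2.
  by exists (s, i), (t, j); split => //; rewrite /e /= sE tE.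
pose ix (x : bip_graph e) := match x with
  | inl b => b.2.*2 + b.1 | inr w => size blacks + (w.2.*2 + w.1) end.
apply: (@table_planar table_points table_edges R _ ix td).
- have half (b c : bool) i j : i.*2 + b = j.*2 + c -> b = c /\ i = j.
    by case: b c => -[] /=; lia.
  have lt (b : bool * 'I_m) : b.2.*2 + b.1 < size blacks.
    by have := ltn_ord b.2; rewrite sb; case: (b.1) => /=; lia.
  case=> [[b i]|[c j]] [[b' i']|[c' j']] //=.
  + by move=> /half[-> /val_inj ->].
  + by move=> h; have := lt (b, i); rewrite /= h; lia.
  + by move=> h; have := lt (b', i'); rewrite /= -h; lia.
  + by move=> /addnI /half[-> /val_inj ->].
- rewrite /table_points size_cat size_map sb sw => -[[b i]|[c j]] /=.
    by have := ltn_ord i; case: b => /=; lia.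
  by have := ltn_ord j; rewrite sb; case: c => /=; lia.
- by case=> [b|w] [b'|w'] //=; auto.
Qed.

End TableGraph.

(** In the three cases below [n * m = 4 * (n + m) - 4], so the split graph is a
    plane quadrangulation and every pair of labels is joined exactly once. *)
Definition blacks_5_16 : seq (nat * nat) :=
  [:: (19, 17); (12, 17); (22, 9); (11, 19); (17, 12); (18, 2); (0, 11); (16, 11); (7, 16);
    (24, 13)].
Definition whites_5_16 : seq ((nat * nat) * seq nat) :=
  [:: ((15, 21), [:: 0; 3; 9]); ((15, 7), [:: 5; 7]);
      ((15, 19), [:: 0; 3; 9]); ((13, 10), [:: 5; 7]);
      ((10, 12), [:: 1; 5; 7]); ((16, 18), [:: 3; 9]);
      ((21, 2), [:: 2; 5; 9]); ((12, 16), [:: 1; 7]); ((17, 7), [:: 5; 7]);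
      ((7, 14), [:: 1; 3; 8]); ((5, 12), [:: 6; 8]); ((19, 9), [:: 1; 2; 4]);
      ((9, 11), [:: 1; 5]); ((14, 24), [:: 3; 6; 9]); ((17, 5), [:: 5; 7]);
      ((17, 16), [:: 1; 3; 9]); ((21, 12), [:: 1; 2]);
      ((21, 0), [:: 5; 6; 9]); ((19, 7), [:: 1; 5; 7]);
      ((22, 12), [:: 2; 9]); ((6, 12), [:: 1; 6; 8]); ((19, 11), [:: 2; 4]);
      ((5, 10), [:: 1; 5; 6]); ((23, 12), [:: 2; 9]);
      ((21, 13), [:: 1; 2; 9]); ((18, 6), [:: 5; 7]); ((5, 14), [:: 6; 8]);
      ((21, 5), [:: 1; 2; 5]); ((4, 14), [:: 3; 6; 8]); ((8, 11), [:: 1; 5]);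
      ((16, 14), [:: 1; 2; 4]); ((4, 12), [:: 6; 8])].

Definition blacks_6_10 : seq (nat * nat) :=
  [:: (4, 1); (8, 7); (6, 17); (19, 0); (9, 9); (7, 2); (1, 20); (4, 16); (3, 11); (15, 15);
    (1, 8); (18, 16)].
Definition whites_6_10 : seq ((nat * nat) * seq nat) :=
  [:: ((8, 4), [:: 1; 5]); ((12, 16), [:: 2; 6; 9; 10]);
      ((6, 9), [:: 1; 4; 9]); ((19, 15), [:: 3; 6; 11]);
      ((9, 10), [:: 4; 9]); ((0, 0), [:: 0; 3; 6; 10]); ((4, 7), [:: 1; 5]);
      ((2, 18), [:: 2; 7; 8; 10]); ((2, 19), [:: 2; 6; 10]);
      ((10, 2), [:: 1; 5; 9]); ((14, 18), [:: 6; 11]);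
      ((11, 1), [:: 0; 3; 5; 9]); ((15, 16), [:: 3; 6; 9]);
      ((5, 3), [:: 0; 5; 10]); ((10, 4), [:: 1; 4; 9]);
      ((20, 20), [:: 3; 6; 11]); ((5, 6), [:: 1; 5]);
      ((7, 15), [:: 2; 7; 8; 10]); ((5, 17), [:: 2; 7]);
      ((3, 8), [:: 1; 5; 9; 10])].

Definition blacks_7_8 : seq (nat * nat) :=
  [:: (6, 12); (7, 1); (4, 5); (20, 16); (6, 8); (16, 16); (8, 14); (2, 5); (10, 17); (6, 2);
    (15, 10); (3, 9); (0, 0); (11, 16)].
Definition whites_7_8 : seq ((nat * nat) * seq nat) :=
  [:: ((5, 6), [:: 1; 2; 7; 9; 11]); ((1, 18), [:: 4; 12]);
      ((12, 4), [:: 0; 4; 6; 11]); ((17, 0), [:: 3; 8; 12]);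
      ((17, 6), [:: 3; 8; 10; 13]); ((5, 13), [:: 0; 4; 6]);
      ((10, 3), [:: 1; 11]); ((1, 19), [:: 3; 4; 6; 8; 12]);
      ((13, 17), [:: 3; 5; 8]); ((1, 4), [:: 1; 7; 11; 12]);
      ((18, 15), [:: 3; 5]); ((16, 1), [:: 1; 6; 8; 11; 12]);
      ((3, 13), [:: 4; 11; 12]); ((4, 3), [:: 1; 2; 7; 9]);
      ((8, 13), [:: 0; 6]); ((19, 14), [:: 3; 5; 8; 10; 13])].

Lemma table_5_16 : table_splits blacks_5_16 whites_5_16 5 16.
Proof. by vm_compute. Qed.

Lemma table_6_10 : table_splits blacks_6_10 whites_6_10 6 10.
Proof. by vm_compute. Qed.

Lemma table_7_8 : table_splits blacks_7_8 whites_7_8 7 8.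
Proof. by vm_compute. Qed.

Lemma splittable_Kmn (R : realType) (m n : nat) :
  n * m <= 4 * (n + m) - 4 -> splittable R 2 (Kmn m n).
Proof.
move=> h.
have [m4|m4] := leqP m 4; first exact: (four_by_n_splittable R n m4).1.
have [n4|n4] := leqP n 4; first exact: (four_by_n_splittable R m n4).2.
(* With [m = a + 5] and [n = b + 5] the bound says [(a + 1) * (b + 1) <= 12]. *)
have : [|| (m <= 5) && (n <= 16), (m <= 6) && (n <= 10), (m <= 7) && (n <= 8),
           (n <= 5) && (m <= 16), (n <= 6) && (m <= 10) | (n <= 7) && (m <= 8)].
  have [[a mE] [b nE]] : (exists a, m = a + 5) /\ (exists b, n = b + 5).
    by split; [exists (m - 5) | exists (n - 5)]; rewrite subnK.
  subst m n; have {h}h : (a.+1 * b.+1 <= 12) by nia.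
  clear -h; case: a h => [|[|[|a]]] h; lia.
case/or4P => [/andP[a b]|/andP[a b]|/andP[a b]|].
- exact: (table_splittable R a b table_5_16).1.
- exact: (table_splittable R a b table_6_10).1.
- exact: (table_splittable R a b table_7_8).1.
case/or3P => /andP[a b].
- exact: (table_splittable R a b table_5_16).2.
- exact: (table_splittable R a b table_6_10).2.
- exact: (table_splittable R a b table_7_8).2.
Qed.

Theorem theorem2 (R : realType) (m n : nat) (hm : (0 < m)%N) (hn : (0 < n)%N) :
  splittable R 2 (Kmn m n) <-> (n * m <= 4 * (n + m) - 4)%N.
Proof.
split; [exact: splittable_Kmn_bound | exact: splittable_Kmn].
Qed.
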